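(* Let $d\ge2$, $\varrho\ge0$, and let $\mathsf{w}$ be a doubling weight on $\mathbb{X}_0^{d+1}$ such that $\mathsf{w}(x,t)=\mathsf{w}(x,-t)$ for all $(x,t)\in\mathbb{X}_0^{d+1}$. There is a $\delta_0>0$ such that for every $0<\delta<\delta_0$, every integer $n\ge1$ and every symmetric maximal $\frac{\delta}{n}$-separated subset $\Xi$ of $\mathbb{X}_0^{d+1}$, there exist positive numbers $\lambda_{z,r}$, $(z,r)\in\Xi$, so that $$\int_{\mathbb{X}_0^{d+1}}f(x,t)\,\mathsf{w}(x,t)\,d\sigma_\varrho(x,t)=\sum_{(z,r)\in\Xi}\lambda_{z,r}\,f(z,r),\qquad\forall f\in\Pi_n^E(\mathbb{X}_0^{d+1}).$$ Moreover, $\lambda_{z,r}\sim\mathsf{w}\big(\mathsf{c}_\varrho((z,r),\tfrac{\delta}{n})\big)$ for all $(z,r)\in\Xi$.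
   Context: For $\varrho\ge0$, $\mathbb{X}_0^{d+1}=\{(x,t)\in\mathbb{R}^d\times\mathbb{R}:\|x\|^2=t^2-\varrho^2,\ \varrho\le|t|\le\sqrt{\varrho^2+1}\}$, with parts $\mathbb{X}_{0,+}^{d+1}=\{t\ge0\}$ and $\mathbb{X}_{0,-}^{d+1}=\{t\le0\}$. For two points in the same part, $\mathsf{d}_{\mathbb{X}_0}^\varrho((x,t),(y,s))=\arccos\big(\langle x,y\rangle+\sqrt{1+\varrho^2-t^2}\sqrt{1+\varrho^2-s^2}\big)$; the ball $\mathsf{c}_\varrho((x,t),r)$ is the set of points $(y,s)$ in the same part as $(x,t)$ with $\mathsf{d}_{\mathbb{X}_0}^\varrho((x,t),(y,s))\le r$. The measure $\sigma_\varrho$ is given by $d\sigma_\varrho(x,t)=d\omega_{\sqrt{t^2-\varrho^2}}(x)\,dt$, where $d\omega_\rho$ is the surface measure on the sphere of radius $\rho$ in $\mathbb{R}^d$. For a weight $\mathsf{w}$, $\mathsf{w}(E)=\int_E\mathsf{w}\,d\sigma_\varrho$. A nonnegative integrable $\mathsf{w}$ (not a.e. zero) is a doubling weight if there is $L>0$ with $\mathsf{w}(\mathsf{c}_\varrho(z,2r))\le L\,\mathsf{w}(\mathsf{c}_\varrho(z,r))$ for all $z\in\mathbb{X}_0^{d+1}$, $r>0$. $\Pi_n^E(\mathbb{X}_0^{d+1})$ is the space of restrictions $p$ to $\mathbb{X}_0^{d+1}$ of polynomials of degree at most $n$ with $p(x,t)=p(x,-t)$ on $\mathbb{X}_0^{d+1}$.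 A finite set $\Xi\subset\mathbb{X}_0^{d+1}$ is $\varepsilon$-separated if $\mathsf{d}_{\mathbb{X}_0}^\varrho(z,z')\ge\varepsilon$ for any two distinct points of $\Xi$ in the same part. It is maximal if $1\le\sum_{z\in\Xi}\chi_{\mathsf{c}_\varrho(z,\varepsilon)}(y)\le c_d$ for all $y\in\mathbb{X}_0^{d+1}$, with a constant $c_d>1$ depending only on $d$. It is (evenly) symmetric if $(0,0)\notin\Xi$ and $\{(z,r)\in\Xi:r<0\}=\{(-z,-r):(z,r)\in\Xi,\ r>0\}$. $A\sim B$ means $c_1A\le B\le c_2A$ with positive constants independent of $n$, $\Xi$ and the point $(z,r)$ (they may depend on $\delta$, $d$, $\varrho$ and $\mathsf{w}$). *)

(* Defs.v *)
From HB Require Import structures.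
From mathcomp Require Import all_boot all_order all_algebra.
From mathcomp Require Import all_classical all_reals all_analysis.
From mathcomp Require Import measurable_realfun.
From mathcomp Require mpoly.

Set Implicit Arguments.
Unset Strict Implicit.
Unset Printing Implicit Defensive.

Import Order.TTheory GRing.Theory Num.Theory.
Import numFieldNormedType.Exports.

Local Open Scope classical_set_scope.
Local Open Scope ring_scope.

(* The product sigma-algebra on row vectors, set up as the library does for
   tuples; for T = R this is the Borel sigma-algebra of R^n. *)
Definition measure_rV_display : measure_display -> measure_display.
Proof. exact. Qed.

Section measurable_rV.
Context {d} {T : sigmaRingType d} (n : nat).

Let coors : 'I_n -> 'rV[T]_n -> T := fun i x => x ord0 i.

Let rV_set0 : g_sigma_preimage coors set0.
Proof. exact: sigma_algebra0. Qed.

Let rV_setC A : g_sigma_preimage coors A -> g_sigma_preimage coors (~` A).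
Proof. exact: sigma_algebraC. Qed.

Let rV_bigcup (F : _^nat) : (forall i, g_sigma_preimage coors (F i)) ->
  g_sigma_preimage coors (\bigcup_i (F i)).
Proof. exact: sigma_algebra_bigcup. Qed.

HB.instance Definition _ := @isMeasurable.Build (measure_rV_display d)
  ('rV[T]_n) (g_sigma_preimage coors) rV_set0 rV_setC rV_bigcup.

End measurable_rV.

Lemma measurable_coor d (T : sigmaRingType d) n (i : 'I_n) :
  measurable_fun [set: 'rV[T]_n] (fun x : 'rV[T]_n => x ord0 i).
Proof.
move=> _ Y mY; rewrite setTI; apply: sub_sigma_algebra => /=.
rewrite -bigcup_seq/=; exists i => /=; first by rewrite mem_index_enum.
by exists Y => //; rewrite setTI.
Qed.

Lemma measurable_fun_coorP d1 d2 (T1 : measurableType d1)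
    (T2 : measurableType d2) n (f : T1 -> 'rV[T2]_n) :
  (forall i, measurable_fun [set: T1] (fun x => f x ord0 i)) ->
  measurable_fun [set: T1] f.
Proof.
move=> mf _ B mB; rewrite setTI.
pose G := [set A : set 'rV[T2]_n | measurable (f @^-1` A)].
suff : measurable `<=` G by exact.
apply: smallest_sub.
  split => /=.
  - by rewrite /G/= preimage_set0.
  - by move=> A; rewrite /G/= setTD preimage_setC; exact: measurableC.
  - by move=> F mF; rewrite /G/= preimage_bigcup; exact: bigcupT_measurable.
rewrite -bigcup_seq => A [i _ [C mC <-]].
by rewrite /G/= setTI; have := mf i measurableT C mC; rewrite setTI.
Qed.

Section geometry.
Context {R : realType} {d : nat}.
Implicit Types x y : 'rV[R]_d.

Definition dotp x y : R := \sum_(i < d) x ord0 i * y ord0 i.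

(* The Euclidean norm; `|x| on 'rV[R]_d is the sup norm. *)
Definition enorm x : R := Num.sqrt (dotp x x).

End geometry.

Section lebesgue_rV.
Context {R : realType}.

Definition consrV n (p : R * 'rV[R]_n) : 'rV[R]_n.+1 :=
  row_mx (\row_(_ < 1) p.1) p.2.

Lemma measurable_consrV n : measurable_fun [set: R * 'rV[R]_n] (@consrV n).
Proof.
apply: measurable_fun_coorP => i.
case: (split_ordP (i : 'I_(1 + n))) => j ->.
  rewrite (_ : (fun _ => _) = fst); first exact: measurable_fst.
  by apply/funext => p; rewrite [LHS]row_mxEl mxE.
rewrite (_ : (fun _ => _) = (fun p : R * 'rV[R]_n => p.2 ord0 j)).
  by apply: (measurableT_comp (measurable_coor j)); exact: measurable_snd.
by apply/funext => p; rewrite [LHS]row_mxEr.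
Qed.

Definition unconsrV n (x : 'rV[R]_n.+1) : R * 'rV[R]_n :=
  (x ord0 ord0, rsubmx (x : 'rV[R]_(1 + n))).

Lemma measurable_unconsrV n : measurable_fun [set: 'rV[R]_n.+1] (@unconsrV n).
Proof.
apply: measurable_fun_pair; first exact: measurable_coor.
apply: measurable_fun_coorP => i.
under eq_fun do rewrite mxE.
exact: measurable_coor.
Qed.

Lemma consrVK n : cancel (@consrV n) (@unconsrV n).
Proof.
case=> t x; rewrite /unconsrV /consrV/= row_mxKr; congr pair.
have := row_mxEl (\row_(_ < 1) t) x ord0 ord0; rewrite mxE => E.
by rewrite -[RHS]E; congr (row_mx _ _ _ _); exact: val_inj.
Qed.

Section step.
Variables (n : nat) (m : {sigma_finite_measure set 'rV[R]_n -> \bar R}).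

Definition lebesgue_rVS : set 'rV[R]_n.+1 -> \bar R :=
  pushforward (@lebesgue_measure R \x m)%E (@consrV n).

Let lebesgue_rVS0 : lebesgue_rVS set0 = 0%E.
Proof. by rewrite /lebesgue_rVS /pushforward preimage_set0 measure0. Qed.

Let lebesgue_rVS_ge0 A : (0 <= lebesgue_rVS A)%E.
Proof. by rewrite /lebesgue_rVS /pushforward measure_ge0. Qed.

Let lebesgue_rVS_additive : semi_sigma_additive lebesgue_rVS.
Proof.
move=> F mF tF mUF; rewrite /lebesgue_rVS /pushforward preimage_bigcup.
apply: measure_semi_sigma_additive.
- by move=> k; rewrite -[X in measurable X]setTI; exact: measurable_consrV.
- apply/trivIsetP => i j _ _ ij; rewrite -preimage_setI.
  by move/trivIsetP : tF => -> //; rewrite preimage_set0.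
- by rewrite -preimage_bigcup -[X in measurable X]setTI; exact: measurable_consrV.
Qed.

HB.instance Definition _ := isMeasure.Build _ _ _ lebesgue_rVS
  lebesgue_rVS0 lebesgue_rVS_ge0 lebesgue_rVS_additive.

Let lebesgue_rVS_sigma_finite : sigma_finite setT lebesgue_rVS.
Proof.
have /sigma_finiteP[F [TF ndF Foo]] := sigma_finiteT (@lebesgue_measure R).
have /sigma_finiteP[G [TG ndG Goo]] := sigma_finiteT m.
exists (fun k => @unconsrV n @^-1` (F k `*` G k)).
  apply/esym; rewrite -preimage_bigcup -subTset => x _ /=.
  have : [set: measurableTypeR R] (unconsrV x).1 by [].
  have : [set: 'rV[R]_n] (unconsrV x).2 by [].
  rewrite TF TG => -[k _ Gky] [l _ Fnx]; exists (maxn l k) => //; split.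
  - by move: Fnx; exact/subsetPset/ndF/leq_maxl.
  - by move: Gky; exact/subsetPset/ndG/leq_maxr.
move=> k; have [mF Fk] := Foo k; have [mG Gk] := Goo k; split.
  rewrite -[X in measurable X]setTI; apply: measurable_unconsrV => //.
  exact: measurableX.
rewrite /lebesgue_rVS /pushforward -comp_preimage.
rewrite (_ : @unconsrV n \o @consrV n = id); last first.
  by apply/funext; exact: consrVK.
by rewrite preimage_id product_measure1E// lte_mul_pinfty// ge0_fin_numE.
Qed.

HB.instance Definition _ := Measure_isSigmaFinite.Build _ _ _ lebesgue_rVS
  lebesgue_rVS_sigma_finite.

End step.

(* Lebesgue measure on R^n, as the n-fold product of Lebesgue measure on R. *)
Fixpoint lebesgue_rV (n : nat) : {sigma_finite_measure set 'rV[R]_n -> \bar R} :=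
  match n with
  | 0%N => dirac (0 : 'rV[R]_0)
  | k.+1 => lebesgue_rVS (lebesgue_rV k)
  end.

End lebesgue_rV.

Section sphere_measure.
Context {R : realType} (d : nat).

Definition direction (x : 'rV[R]_d) : 'rV[R]_d := (enorm x)^-1 *: x.

Definition punctured_ball : set 'rV[R]_d := [set x | 0 < enorm x <= 1].

(* Surface measure on the unit sphere of R^d through polar coordinates: the
   surface area of A is d times the volume of the cone {s *: xi | xi in A,
   0 < s <= 1}. The points of that cone are those of the punctured unit ball
   whose direction is in A. *)
Definition unit_sphere_measure (A : set 'rV[R]_d) : \bar R :=
  (d%:R%:E * lebesgue_rV d (direction @^-1` A `&` punctured_ball))%E.

(* Surface measure on the sphere of radius r, null for r = 0 and d >= 2. *)
Definition sphere_measure (r : R) (A : set 'rV[R]_d) : \bar R :=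
  ((r ^+ d.-1)%:E * unit_sphere_measure [set x | A (r *: x)])%E.

Lemma measurable_enorm : measurable_fun [set: 'rV[R]_d] enorm.
Proof.
apply: (measurableT_comp (f := @Num.sqrt R)).
  by apply: continuous_measurable_fun; exact: sqrt_continuous.
apply: measurable_sum => i.
by apply: measurable_funM; exact: measurable_coor.
Qed.

Lemma measurable_direction : measurable_fun setT direction.
Proof.
apply: measurable_fun_coorP => i.
rewrite (_ : (fun _ => _) = fun x => enorm x `^ (- 1) * x ord0 i).
  apply: measurable_funM; last exact: measurable_coor.
  apply: (measurableT_comp (f := fun z : R => z `^ (- 1))).
    exact: measurable_powR.
  exact: measurable_enorm.
by apply/funext => x; rewrite mxE powR_inv1// sqrtr_ge0.
Qed.

Lemma measurable_punctured_ball : measurable punctured_ball.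
Proof.
rewrite (_ : punctured_ball = enorm @^-1` `]0, 1]).
  rewrite -[X in measurable X]setTI; apply: measurable_enorm => //.
by apply/seteqP; split => x /=; rewrite in_itv.
Qed.

Let mu : {measure set 'rV[R]_d -> \bar R} := lebesgue_rV d.

Let nu : {measure set 'rV[R]_d -> \bar R} :=
  mscale (NngNum (ler0n R d)) (mrestr mu measurable_punctured_ball).

Let unit_sphere_measureE A : unit_sphere_measure A = nu (direction @^-1` A).
Proof. by []. Qed.

Let unit_sphere_measure0 : unit_sphere_measure set0 = 0%E.
Proof. by rewrite unit_sphere_measureE preimage_set0 measure0. Qed.

Let unit_sphere_measure_ge0 A : (0 <= unit_sphere_measure A)%E.
Proof. by rewrite unit_sphere_measureE measure_ge0. Qed.

Let unit_sphere_measure_additive : semi_sigma_additive unit_sphere_measure.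
Proof.
move=> F mF tF mUF; rewrite unit_sphere_measureE preimage_bigcup.
under eq_fun do under eq_bigr do rewrite unit_sphere_measureE.
apply: measure_semi_sigma_additive.
- by move=> k; rewrite -[X in measurable X]setTI; exact: measurable_direction.
- apply/trivIsetP => i j _ _ ij; rewrite -preimage_setI.
  by move/trivIsetP : tF => -> //; rewrite preimage_set0.
- rewrite -preimage_bigcup -[X in measurable X]setTI.
  exact: measurable_direction.
Qed.

HB.instance Definition _ := isMeasure.Build _ _ _ unit_sphere_measure
  unit_sphere_measure0 unit_sphere_measure_ge0 unit_sphere_measure_additive.

Lemma measurable_fun_sphere_measure (s : R -> R) (E : set ('rV[R]_d * R)) :
  measurable_fun setT s -> measurable E ->
  measurable_fun setT (fun t => sphere_measure (s t) (ysection E t)).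
Proof.
move=> ms mE; rewrite /sphere_measure.
apply: emeasurable_funM.
  by apply/measurable_EFinP; exact: measurable_funX.
apply: emeasurable_funM; first exact: measurable_cst.
pose g (p : 'rV[R]_d * R) := (s p.2 *: direction p.1, p.2).
have mg : measurable_fun setT g.
  apply: measurable_fun_pair; last exact: measurable_snd.
  apply: measurable_fun_coorP => i.
  rewrite (_ : (fun _ => _) = fun p => s p.2 * (direction p.1) ord0 i).
    apply: measurable_funM; first exact: (measurableT_comp ms).
    apply: (measurableT_comp (measurable_coor i)).
    exact: (measurableT_comp measurable_direction).
  by apply/funext => p; rewrite mxE.
pose P := (g @^-1` E) `&` (punctured_ball `*` setT).
have mP : measurable P.
  apply: measurableI.
    by rewrite -[X in measurable X]setTI; exact: mg.
  by apply: measurableX => //; exact: measurable_punctured_ball.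
rewrite (_ : (fun _ => _) = lebesgue_rV d \o ysection P).
  exact: measurable_fun_ysection.
apply/funext => t /=; congr (lebesgue_rV d _).
apply/seteqP; split => x /=; rewrite /ysection /P/= inE.
  by rewrite !in_setE => -[].
by rewrite /ysection/= => -[? []]; rewrite ?in_setE.
Qed.

End sphere_measure.

Section hyperbolic_surface.
Context {R : realType} {d : nat} (rho : R).
Local Notation point := ('rV[R]_d * R)%type.

Definition heights : set R :=
  [set t | rho <= `|t| <= Num.sqrt (rho ^+ 2 + 1)].

Definition X0 : set point :=
  [set z | enorm z.1 ^+ 2 = z.2 ^+ 2 - rho ^+ 2 /\ heights z.2].

(* The apex (0, 0), which exists only for rho = 0, lies in both parts. *)
Definition same_part (z y : point) : Prop :=
  (0 <= z.2 /\ 0 <= y.2) \/ (z.2 <= 0 /\ y.2 <= 0).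

Definition dist_X0 (z y : point) : R :=
  acos (dotp z.1 y.1 + Num.sqrt (1 + rho ^+ 2 - z.2 ^+ 2) *
                       Num.sqrt (1 + rho ^+ 2 - y.2 ^+ 2)).

Definition cball (z : point) (r : R) : set point :=
  [set y | [/\ X0 y, same_part z y & dist_X0 z y <= r]].

Definition sigma (E : set point) : \bar R :=
  (\int[@lebesgue_measure R]_(t in heights)
     sphere_measure (Num.sqrt (t ^+ 2 - rho ^+ 2)) (ysection E t))%E.

Lemma measurable_heights : measurable heights.
Proof.
rewrite (_ : heights = Num.norm @^-1` `[rho, Num.sqrt (rho ^+ 2 + 1)]).
  rewrite -[X in measurable X]setTI.
  by apply: continuous_measurable_fun => //; exact: norm_continuous.
by apply/seteqP; split => t; rewrite /heights/= in_itv.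
Qed.

Let radius (t : R) : R := Num.sqrt (t ^+ 2 - rho ^+ 2).

Let measurable_radius : measurable_fun setT radius.
Proof.
apply: (measurableT_comp (f := @Num.sqrt R)).
  by apply: continuous_measurable_fun; exact: sqrt_continuous.
apply: measurable_funB => //; exact: measurable_funX.
Qed.

Let sphere_measure_radius_ge0 t (A : set 'rV[R]_d) : (0 <= sphere_measure (radius t) A)%E.
Proof.
by apply: mule_ge0; rewrite ?measure_ge0// lee_fin exprn_ge0// sqrtr_ge0.
Qed.

Let sigma0 : sigma set0 = 0%E.
Proof.
apply: integral0_eq => t _.
rewrite ysection0 /sphere_measure (_ : [set _ | _] = set0).
  by rewrite measure0 mule0.
by apply/seteqP; split.
Qed.

Let sigma_ge0 E : (0 <= sigma E)%E.
Proof. by apply: integral_ge0 => t _; exact: sphere_measure_radius_ge0. Qed.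

Let sigma_additive : semi_sigma_additive sigma.
Proof.
move=> F mF tF mUF.
rewrite [X in _ --> X](_ : _ = \sum_(n <oo) sigma (F n))%E.
  by apply/cvg_closeP; split; [exact: is_cvg_nneseries|rewrite closeE].
rewrite -integral_nneseries//; first last.
- by move=> n t _; exact: sphere_measure_radius_ge0.
- move=> n; apply: measurable_funTS.
  exact: (measurable_fun_sphere_measure measurable_radius).
- exact: measurable_heights.
apply: eq_integral => t _; rewrite ysection_bigcup /sphere_measure.
rewrite nneseriesZl//.
congr (_ * _)%E.
pose G n := [set x | ysection (F n) t (radius t *: x)].
have mG n : measurable (G n).
  have mS : measurable_fun setT (fun x : 'rV[R]_d => radius t *: x).
    apply: measurable_fun_coorP => i.
    rewrite (_ : (fun _ => _) = fun x : 'rV[R]_d => radius t * x ord0 i).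
      apply: measurable_funM; [exact: measurable_cst|exact: measurable_coor].
    by apply/funext => x; rewrite mxE.
  rewrite -[X in measurable X]setTI; apply: mS => //.
  exact: measurable_ysection.
have tG : trivIset setT G.
  apply/trivIsetP => i j _ _ ij; apply/seteqP; split => // x [Gi Gj].
  move/trivIsetP : (trivIset_ysection (y := t) tF) => /(_ i j Logic.I Logic.I ij).
  by rewrite -subset0 => /(_ (radius t *: x)); apply; split.
rewrite (_ : [set _ | _] = \bigcup_n G n); last first.
  by apply/seteqP; split.
by apply/esym/cvg_lim => //; exact: measure_sigma_additive mG tG.
Qed.

HB.instance Definition _ := isMeasure.Build _ _ _ sigma
  sigma0 sigma_ge0 sigma_additive.

End hyperbolic_surface.

Section cubature_setting.
Context {R : realType} {d : nat} (rho : R).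
Local Notation point := ('rV[R]_d * R)%type.
Implicit Types (w f : point -> R) (Xi : set point).

Definition weight_measure w (E : set point) : \bar R :=
  (\int[sigma rho]_(z in E) (w z)%:E)%E.

Definition doubling_weight w : Prop :=
  [/\ forall z, X0 rho z -> 0 <= w z,
      (sigma rho).-integrable (X0 rho) (EFin \o w),
      ~ {ae sigma rho, forall z, X0 rho z -> w z = 0} &
      exists2 L : R, 0 < L & forall (z : point) (r : R), X0 rho z -> 0 < r ->
        (weight_measure w (cball rho z (2 * r)) <=
         L%:E * weight_measure w (cball rho z r))%E].

Definition coordinates (z : point) (i : 'I_(d + 1)) : R :=
  row_mx z.1 (\row_(_ < 1) z.2) ord0 i.

(* Functions are given on the whole of R^d * R, but only their values on X0
   are constrained. *)
Definition PiE (n : nat) : set (point -> R) :=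
  [set f | (exists2 p : mpoly.mpoly (d + 1) R,
              forall m, mpoly.mcoeff m p != 0 -> (mpoly.mdeg m <= n)%N &
              forall z, X0 rho z -> f z = mpoly.meval (coordinates z) p) /\
           forall (x : 'rV[R]_d) (t : R), X0 rho (x, t) -> f (x, t) = f (x, - t)].

Definition separated (eps : R) Xi : Prop :=
  [/\ finite_set Xi, Xi `<=` X0 rho &
      forall z z', Xi z -> Xi z' -> z != z' -> same_part z z' ->
        eps <= dist_X0 rho z z'].

Definition maximal_separated (cd eps : R) Xi : Prop :=
  separated eps Xi /\
  forall y, X0 rho y ->
    1 <= \sum_(z \in Xi) (\1_(cball rho z eps) y : R) <= cd.

Definition evenly_symmetric Xi : Prop :=
  ~ Xi (0, 0) /\
  [set z | Xi z /\ z.2 < 0] =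
    [set (- z.1, - z.2) | z in [set z | Xi z /\ 0 < z.2]].

End cubature_setting.

(* Main.v *)
Require Import Defs.
From mathcomp Require Import all_boot all_order all_algebra.
From mathcomp Require Import all_classical all_reals all_analysis.
From mathcomp Require Import measurable_realfun ring lra.
From mathcomp Require Import -(notations) mpoly.

(* Folding (x,t) and (x,-t) together, X0 becomes the upper unit hemisphere of
   R^(d+1) through (x,t) |-> (x, sqrt (1+rho^2-t^2)), the distance becomes the
   geodesic one, and an even polynomial of degree n restricts to a trigonometric
   polynomial of degree n on every great circle. Localizing with a power of the
   Dirichlet kernel, which decays away from the point, gives the Bernstein-type
   bound |f v - f y| <= C n d(y,v) f*(y) for d(y,v) <= 1/n, where
   f*(y) = sup_v |f v| / (1 + n d(y,v))^l is Peetre's maximal function.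

   For doubling weights the sum of w(c(z,delta/n)) f*(z) over Xi is bounded by
   the corresponding sum of |f z|, with a constant independent of delta. Hence
   for small delta the integral of f w differs from the Riemann sum of the m_z f z,
   where m_z ~ w(c(z,delta/n)), by at most half of the sum of the m_z |f z|, so
   the functional f |-> int f w - (1/2) sum m_z f z is nonnegative on the f >= 0 on
   Xi, and is a nonnegative combination of point evaluations. This gives the
   nodes weights >= m_z / 2; the upper bound comes from testing the formula on a
   nonnegative polynomial of degree n peaked at z. *)

Set Implicit Arguments.
Unset Strict Implicit.
Unset Printing Implicit Defensive.

Import Order.TTheory GRing.Theory Num.Theory.
Import numFieldNormedType.Exports.

Local Open Scope classical_set_scope.
Local Open Scope ring_scope.

(** * Trigonometric polynomials *)


(** The constant in the bound for the sums of Peetre's maximal function must be fixed before delta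
    is. It is therefore obtained by averaging |f| over balls of radius eps / n, where eps depends
    only on the Bernstein-type constant; delta <= eps / 2 ensures that these balls are well filled
    by nodes, and the doubling loss is a power of 4 / eps, not of 1 / delta.

    If 2 ^ s is the doubling constant, the maximal function has exponent 3 s + 1: s powers pay for
    comparing the unit ball at z with a ball at a near-maximizer, s for exchanging the masses of
    unit balls at two points, and s + 1 make the sum over the nodes converge.

    Folding may bring nodes of opposite parts together, even to distance zero. The m_z are thus
    integrals over a partition of unity subordinate to the folded balls, whose overlap is at most
    twice [cd]. *)

Section elementary_trigonometry.
Context {R : realType}.
Implicit Types x y u v : R.

Lemma sin_mvt x : 0 < x -> exists2 c, 0 < c < x & sin x = cos c * x.
Proof.
move=> x0.
have [|c] := @MVT R sin cos 0 x x0 (fun y _ => is_derive_sin y).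
  by apply: continuous_subspaceT => y; exact: continuous_sin.
by rewrite in_itv/= sin0 !subr0 => c0x ->; exists c.
Qed.

Lemma norm_sin_le x : `|sin x| <= `|x|.
Proof.
wlog x0 : x / 0 < x => [H|].
  case: (ltrgtP x 0) => [x0|/H//|->]; last by rewrite sin0.
  by rewrite -normrN -sinN -(normrN x); apply: H; rewrite oppr_gt0.
have [c _ ->] := sin_mvt x0.
by rewrite normrM ler_piMl// cos_max.
Qed.

Lemma cosB_prod x y : cos x - cos y = - 2 * sin ((x + y) / 2) * sin ((x - y) / 2).
Proof.
have -> : cos x = cos ((x + y) / 2 + (x - y) / 2) by congr cos; field.
have -> : cos y = cos ((x + y) / 2 - (x - y) / 2) by congr cos; field.
by rewrite cosB cosD; ring.
Qed.

Lemma cos_lipschitz x y : `|cos x - cos y| <= `|x - y|.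
Proof.
rewrite cosB_prod !normrM normrN (ger0_norm (_ : 0 <= 2))//.
have h1 := sin_max ((x + y) / 2).
have := norm_sin_le ((x - y) / 2); rewrite normrM (ger0_norm (_ : 0 <= 2^-1))//.
have := normr_ge0 (sin ((x - y) / 2)).
set a := `|sin _| in h1 *; set b := `|sin _|; set c := `|_|.
move=> b0 bc; apply: (@le_trans _ _ (2 * 1 * b)); last by lra.
by rewrite ler_wpM2r// ler_wpM2l.
Qed.

Lemma cos_ge_quadratic x : 1 - x ^+ 2 / 2 <= cos x.
Proof.
have -> : cos x = 1 - 2 * sin (x / 2) ^+ 2.
  rewrite sin2cos2 -{1}(_ : (x / 2) *+ 2 = x) ?cos_mulr2n; last by rewrite -mulr_natr; field.
  by rewrite -mulr_natr; ring.
have : sin (x / 2) ^+ 2 <= (x / 2) ^+ 2.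
  by rewrite -real_normK ?num_real// -[leRHS]real_normK ?num_real// lerXn2r ?nnegrE ?norm_sin_le.
lra.
Qed.

(** Halve once more: sin (x/2) = 2 sin (x/4) cos (x/4), and on [0, 5/4] the quadratic bound gives
    cos >= 1 - 25/32 = 7/32. The range up to 5 is what differences x - phi with |x| <= 1 and |phi|
    <= pi require. *)
Lemma sin_half_ge x : 0 <= x <= 5 -> x / 60 <= sin (x / 2).
Proof.
case/andP; rewrite le_eqVlt => /predU1P[<- _|x0 x5]; first by rewrite !mul0r sin0.
have x40 : 0 < x / 4 by lra.
have c7 c : 0 < c <= x / 4 -> 7/32 <= cos c.
  by move=> /andP[c0 cx]; have := cos_ge_quadratic c; nra.
have [c /andP[c0 cx] e] := sin_mvt x40.
have -> : x / 2 = (x / 4) *+ 2 by rewrite -mulr_natr; field.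
rewrite sin_mulr2n e -mulr_natr.
have h1 := c7 (x/4); have h2 := c7 c.
have {}h1 : 7/32 <= cos (x/4) by apply: h1; rewrite lexx x40.
have {}h2 : 7/32 <= cos c by apply: h2; rewrite c0 ltW.
have : 49/1024 <= cos (x/4) * cos c by nra.
nra.
Qed.

End elementary_trigonometry.

Section dirichlet_kernel.
Context {R : realType}.
Implicit Types x y u v : R.

(** Telescoping: 2 sin (h/2) cos t = sin (t + h/2) - sin (t - h/2). *)
Lemma sum_cos_arithmetic (N : nat) (b h : R) :
  2 * sin (h / 2) * \sum_(k < N) cos (b + k%:R * h) =
  sin (b + N%:R * h - h / 2) - sin (b - h / 2).
Proof.
elim: N => [|N IH]; first by rewrite big_ord0 mul0r addr0; ring.
rewrite big_ord_recr/= mulrDr IH.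
have -> : b + N.+1%:R * h - h / 2 = (b + N%:R * h) + h / 2 by rewrite -natr1; field.
by rewrite (sinB (b + N%:R * h)) (sinD (b + N%:R * h)); ring.
Qed.

(** Normalized to be 1 at 0. The index k stands for the frequency k - M, so that the terms form an
    arithmetic progression and the sum has a closed form. *)
Definition dirichlet (M : nat) u : R :=
  (2 * M%:R + 1)^-1 * \sum_(k < M.*2.+1) cos ((k%:R - M%:R) * u).

Let NE M : (M.*2.+1)%:R = 2 * M%:R + 1 :> R.
Proof. by rewrite -natr1 -mul2n natrM. Qed.

Let N_gt0 M : 0 < 2 * M%:R + 1 :> R.
Proof. by rewrite -NE. Qed.

Lemma dirichlet0 M : dirichlet M 0 = 1.
Proof.
rewrite /dirichlet; under eq_bigr do rewrite mulr0 cos0.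
by rewrite sumr_const card_ord NE mulVf// gt_eqF// N_gt0.
Qed.

Lemma dirichletN M u : dirichlet M (- u) = dirichlet M u.
Proof. by congr *%R; apply: eq_bigr => k _; rewrite mulrN cosN. Qed.

Lemma norm_dirichlet_le1 M u : `|dirichlet M u| <= 1.
Proof.
rewrite /dirichlet normrM gtr0_norm ?invr_gt0 ?N_gt0// ler_pdivrMl ?N_gt0// mulr1.
apply: le_trans (ler_norm_sum _ _ _) _.
apply: (@le_trans _ _ (\sum_(k < M.*2.+1) 1)).
  by apply: ler_sum => k _; exact: cos_max.
by rewrite sumr_const card_ord NE.
Qed.

Lemma dirichlet_lipschitz M u v :
  `|dirichlet M u - dirichlet M v| <= M%:R * `|u - v|.
Proof.
rewrite /dirichlet -mulrBr -sumrB normrM gtr0_norm ?invr_gt0 ?N_gt0//.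
rewrite ler_pdivrMl ?N_gt0//.
apply: le_trans (ler_norm_sum _ _ _) _.
apply: (@le_trans _ _ (\sum_(k < M.*2.+1) M%:R * `|u - v|)).
  apply: ler_sum => k _; apply: le_trans (cos_lipschitz _ _) _.
  rewrite -mulrBr normrM ler_wpM2r//.
  have : (k <= 2 * M)%N by rewrite mul2n -ltnS.
  rewrite -(ler_nat R) natrM ler_norml => kM.
  by apply/andP; split; have := ler0n R k; lra.
by rewrite sumr_const card_ord -[leLHS]mulr_natl NE.
Qed.

Lemma dirichlet_sin M u :
  (2 * M%:R + 1) * (sin (u / 2) * dirichlet M u) = sin ((M%:R + 1/2) * u).
Proof.
rewrite /dirichlet [sin _ * _]mulrCA mulVKf ?gt_eqF ?N_gt0//.
have := sum_cos_arithmetic M.*2.+1 (- M%:R * u) u.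
rewrite NE.
rewrite (_ : - M%:R * u + (2 * M%:R + 1) * u - u / 2 = (M%:R + 1/2) * u); last by field.
rewrite (_ : - M%:R * u - u / 2 = - ((M%:R + 1/2) * u)); last by field.
rewrite sinN opprK.
under eq_bigr do rewrite -mulrDl addrC.
set S := \sum_(_ < _) _ => H.
by lra.
Qed.

(** In 31 = 1 + 30, the 1 is the trivial bound and 30 comes from the closed form with sin (u/2) >= u
    / 60. *)
Lemma dirichlet_decay M u : `|u| <= 5 -> `|dirichlet M u| * (1 + M%:R * `|u|) <= 31.
Proof.
wlog u0 : u / 0 <= u => [H|].
  have [/H//|u0] := leP 0 u.
  by rewrite -normrN -dirichletN; apply: H; rewrite oppr_ge0 ltW.
rewrite (ger0_norm u0) => u5.
have := norm_dirichlet_le1 M u; have := dirichlet_sin M u.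
have := @sin_half_ge R u; rewrite u0 u5 => /(_ isT).
have := sin_max ((M%:R + 1/2) * u).
have M0 := ler0n R M.
move=> h1 h2 h3 h4; rewrite mulrDr mulr1.
suff : `|dirichlet M u| * (M%:R * u) <= 30 by lra.
have s0 : 0 <= sin (u / 2) by apply: le_trans h2; lra.
have : (2 * M%:R + 1) * (sin (u/2) * `|dirichlet M u|) <= 1.
  rewrite -(ger0_norm s0) -normrM -(ger0_norm (ltW (N_gt0 M))) -normrM.
  by rewrite h3.
have := normr_ge0 (dirichlet M u).
set D := `|dirichlet _ _| => D0.
have : D * (u / 60) <= sin (u / 2) * D by rewrite mulrC ler_wpM2r.
set S := sin _ * D => DS.
have : 0 <= D * u by nra.
nra.
Qed.

End dirichlet_kernel.

Section trigonometric_polynomials.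
Context {R : realType}.

(** The phase makes sines redundant and keeps the waves closed under translation, so that
    product-to-sum is a single computation. *)
Inductive trig (n : nat) : (R -> R) -> Prop :=
| trig_wave (c a : R) (j : nat) : (j <= n)%N ->
    trig n (fun x => c * cos (j%:R * x + a))
| trig_add f g : trig n f -> trig n g -> trig n (f \+ g).

Lemma trig_ext n f g : trig n f -> f =1 g -> trig n g.
Proof. by move=> tf /funext <-. Qed.

Lemma trig_leq m n f : (m <= n)%N -> trig m f -> trig n f.
Proof.
move=> mn; elim => [c a j jm|g h _ ? _ ?]; last exact: trig_add.
by apply: trig_wave; exact: leq_trans mn.
Qed.

Lemma trig_cst n c : trig n (cst c).
Proof.
apply: (@trig_ext _ (fun x => c * cos (0%:R * x + 0))); first exact: trig_wave.
by move=> x /=; rewrite mul0r addr0 cos0 mulr1.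
Qed.

Lemma trig_sum n (I : Type) (s : seq I) (P : pred I) (F : I -> R -> R) :
  (forall i, P i -> trig n (F i)) -> trig n (fun x => \sum_(i <- s | P i) F i x).
Proof.
move=> tF; elim: s => [|i s IH].
  by apply: trig_ext (trig_cst n 0) _ => x; rewrite big_nil.
case: (boolP (P i)) => [Pi|nPi].
  by apply: trig_ext (trig_add (tF i Pi) IH) _ => x; rewrite big_cons Pi.
by apply: trig_ext IH _ => x; rewrite big_cons (negbTE nPi).
Qed.

Lemma trig_waveB n (c b a : R) (j k : nat) : (j <= n)%N -> (k <= n)%N ->
  trig n (fun x => c * cos ((j%:R - k%:R) * (b - x) + a)).
Proof.
move=> jn kn; have [jk|kj] := leqP j k.
  apply: (@trig_ext _ (fun x => c * cos ((k - j)%:R * x + ((j%:R - k%:R) * b + a)))).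
    by apply: trig_wave; exact: leq_trans (leq_subr _ _) kn.
  by move=> x; congr (_ * cos _); rewrite natrB//; ring.
apply: (@trig_ext _ (fun x => c * cos ((j - k)%:R * x + (- (j%:R - k%:R) * b - a)))).
  by apply: trig_wave; exact: leq_trans (leq_subr _ _) jn.
by move=> x; rewrite -cosN; congr (_ * cos _); rewrite natrB ?(ltnW kj)//; ring.
Qed.

Lemma trigM m n f g : trig m f -> trig n g -> trig (m + n) (f \* g).
Proof.
move=> tf tg; elim: tf => [c a j jm|f1 f2 _ IH1 _ IH2]; last first.
  by apply: trig_ext (trig_add IH1 IH2) _ => x /=; rewrite mulrDl.
elim: tg => [e b k kn|g1 g2 _ IH1 _ IH2]; last first.
  by apply: trig_ext (trig_add IH1 IH2) _ => x /=; rewrite mulrDr.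
have h1 : trig (m + n) (fun x => c * e / 2 * cos ((j + k)%N%:R * x + (a + b))).
  by apply: trig_wave; exact: leq_add.
have h2 : trig (m + n) (fun x => c * e / 2 * cos ((j%:R - k%:R) * (0 - x) + (b - a))).
  by apply: trig_waveB; [exact: leq_trans (leq_addr _ _)|exact: leq_trans (leq_addl _ _)].
apply: trig_ext (trig_add h1 h2) _ => x /=.
have -> : (j + k)%:R * x + (a + b) = (j%:R * x + a) + (k%:R * x + b).
  by rewrite natrD; ring.
have -> : (j%:R - k%:R) * (0 - x) + (b - a) = - ((j%:R * x + a) - (k%:R * x + b)) by ring.
by rewrite cosN cosD cosB; field.
Qed.

Lemma trigX n f k : trig n f -> trig (n * k) (fun x => f x ^+ k).
Proof.
move=> tf; elim: k => [|k IH].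
  by apply: trig_ext (trig_cst _ 1) _ => x; rewrite expr0.
by rewrite mulnS; apply: trig_ext (trigM tf IH) _ => x /=; rewrite exprS.
Qed.

Lemma trig_dirichlet M b : trig M (fun x => dirichlet M (b - x)).
Proof.
apply: (@trig_ext _ (fun x => \sum_(k < M.*2.+1)
   (2 * M%:R + 1)^-1 * cos ((k%:R - M%:R) * (b - x)))); last first.
  by move=> x; rewrite -mulr_sumr.
apply: trig_sum => k _; have [kM|Mk] := leqP k M.
  by apply: trig_ext (trig_waveB _ b 0 kM (leqnn M)) _ => x; rewrite addr0.
have Mk' : (k - M <= M)%N.
  by rewrite leq_subLR addnn -ltnS.
apply: trig_ext (trig_waveB _ b 0 Mk' (leq0n M)) _ => x.
by rewrite addr0 subr0 natrB// ltnW.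
Qed.

(** The progression of step q h closes up after N terms (total 2 pi q), so the telescoped sum
    vanishes, while its factor sin (pi q / N) does not because 0 < q < N. *)
Lemma sum_cos_nodes (N q : nat) (b t0 : R) : (0 < q < N)%N ->
  \sum_(k < N) cos (b + q%:R * (t0 + k%:R * (pi *+ 2 / N%:R))) = 0.
Proof.
case/andP=> q0 qN; set h := pi *+ 2 / N%:R.
have N0 : (0 < N)%N by exact: leq_trans qN.
have N0R : 0 < N%:R :> R by rewrite ltr0n.
have := sum_cos_arithmetic N (b + q%:R * t0) (q%:R * h).
have -> : b + q%:R * t0 + N%:R * (q%:R * h) - q%:R * h / 2
        = b + q%:R * t0 - q%:R * h / 2 + pi *+ 2 *+ q.
  by rewrite -[pi *+ 2 *+ q]mulr_natl /h -mulr_natl; field; rewrite gt_eqF.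
rewrite (periodicn (@sinD2pi R)) subrr => /eqP.
rewrite mulf_eq0 mulf_eq0 pnatr_eq0/= => /orP[|/eqP H].
  rewrite gt_eqF// sin_gt0_pi//.
  have -> : q%:R * h / 2 = q%:R / N%:R * pi.
    by rewrite /h -mulr_natl; field; rewrite gt_eqF.
  have qNR : q%:R < N%:R :> R by rewrite ltr_nat.
  have q0R : 0 < q%:R :> R by rewrite ltr0n.
  have p0 := @pi_gt0 R.
  by rewrite mulr_gt0 ?divr_gt0//= gtr_pMl// ltr_pdivrMr// mul1r.
rewrite -[RHS]H; apply: eq_bigr => k _; congr cos; ring.
Qed.

(** The sine half of the addition formula cancels under i -> 2 M - i. *)
Lemma dirichlet_mulcos M (a y : R) :
  cos a * dirichlet M y = (2 * M%:R + 1)^-1 *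
    \sum_(i < M.*2.+1) cos (a + (i%:R - M%:R) * y).
Proof.
rewrite /dirichlet mulrCA; congr *%R.
under [RHS]eq_bigr do rewrite cosD.
rewrite big_split/= sumrN -!mulr_sumr.
suff -> : \sum_(i < M.*2.+1) sin ((i%:R - M%:R) * y) = 0 by rewrite mulr0 subr0.
set S := \sum_(_ < _) _.
suff : S = - S by lra.
rewrite {1}/S (reindex_inj rev_ord_inj)/= -sumrN; apply: eq_bigr => i _.
rewrite -sinN; congr sin.
rewrite subSS natrB; last by rewrite -ltnS.
have -> : (M.*2)%:R = 2 * M%:R :> R by rewrite -mul2n natrM.
by ring.
Qed.

Lemma trig_interpolation M f (t0 x : R) : trig M f ->
  let node k := t0 + k%:R * (pi *+ 2 / (M.*2.+1)%:R) in
  f x = \sum_(k < M.*2.+1) f (node k) * dirichlet M (x - node k).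
Proof.
move=> tf node; elim: tf => [c a j jM|g h _ IHg _ IHh]; last first.
  by rewrite /= IHg IHh -big_split/=; apply: eq_bigr => k _; rewrite mulrDl.
under eq_bigr do rewrite -mulrA dirichlet_mulcos.
rewrite -mulr_sumr; congr *%R; rewrite -mulr_sumr exchange_big/=.
have jN : (j + M < M.*2.+1)%N by rewrite ltnS -addnn leq_add2r.
(* As a function of the node, the i-th term has frequency j + M - i, of absolute value at most 2 M,
   which is below the number of nodes: only i = j + M survives, and there the node cancels from the
   phase. *)
rewrite (bigD1 (Ordinal jN))//= [X in _ * (_ + X)]big1 ?addr0; last first.
  move=> i ij; pose b := a + (i%:R - M%:R) * x.
  have [ijM|jMi] := leqP i (j + M)%N.
    rewrite -[RHS](@sum_cos_nodes M.*2.+1 (j + M - i) b t0).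
      apply: eq_bigr => k _; congr cos.
      by rewrite /b /node natrB// natrD; ring.
    rewrite subn_gt0 ltn_neqAle ijM andbT -val_eqE/= in ij *.
    by rewrite ij/=; apply: leq_ltn_trans (leq_subr _ _) jN.
  rewrite -[RHS](@sum_cos_nodes M.*2.+1 (i - (j + M)) (- b) t0).
    apply: eq_bigr => k _; rewrite -cosN; congr cos.
    by rewrite /b /node natrB ?(ltnW jMi)// natrD; ring.
  by rewrite subn_gt0 jMi/=; apply: leq_ltn_trans (leq_subr _ _) (ltn_ord _).
rewrite (eq_bigr (fun=> cos (j%:R * x + a))).
  rewrite sumr_const card_ord.
  have NE : (M.*2.+1)%:R = 2 * M%:R + 1 :> R by rewrite -natr1 -mul2n natrM.
  have -> (y : R) : y *+ M.*2.+1 = (2 * M%:R + 1) * y by rewrite -NE mulr_natl.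
  by rewrite mulKf// gt_eqF// ltr_wpDl// mulr_ge0.
by move=> k _; congr cos; rewrite /node natrD; ring.
Qed.

End trigonometric_polynomials.


(** * Localized reproducing kernels and Chebyshev polynomials *)

Section trigonometric_estimates.
Context {R : realType}.

Lemma sum_inv_sqr n : \sum_(0 <= k < n) ((1 + k%:R) ^+ 2)^-1 <= 2 :> R.
Proof.
(* The induction carries the remainder 1 / (n + 1), since 1 / (n + 2)^2 <= 1 / (n + 1) - 1 / (n +
   2). *)
have H : \sum_(0 <= k < n.+1) ((1 + k%:R) ^+ 2)^-1 <= 2 - n.+1%:R^-1 :> R.
  elim: n => [|n IH]; first by rewrite big_nat1 addr0 expr1n invr1; lra.
  rewrite big_nat_recr//=; apply: le_trans (lerD IH (lexx _)) _.
  have n0 := ler0n R n.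
  have -> : n.+2%:R = n%:R + 2 :> R by rewrite -addn2 natrD.
  have -> : n.+1%:R = n%:R + 1 :> R by rewrite natr1.
  rewrite -subr_ge0.
  have -> : 2 - (n%:R + 2)^-1 - (2 - (n%:R + 1)^-1 + ((1 + (n%:R + 1)) ^+ 2)^-1)
    = ((n%:R + 1) * (n%:R + 2) ^+ 2)^-1 :> R.
    by field; rewrite !gt_eqF//; lra.
  by rewrite invr_ge0 mulr_ge0 ?exprn_ge0//; lra.
apply: le_trans (_ : _ <= \sum_(0 <= k < n.+1) ((1 + k%:R) ^+ 2)^-1) _.
  by rewrite big_nat_recr//= lerDl invr_ge0 sqr_ge0.
by apply: le_trans H _; rewrite gerBl.
Qed.

Lemma sum_inv_sqr_nodes M (c : R) : 0 < c <= 1 ->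
  \sum_(k < M.*2.+1) ((1 + c * `|k%:R - M%:R|) ^+ 2)^-1 <= 4 / c ^+ 2.
Proof.
move=> /andP[c0 c1].
have H (k : nat) (x : R) : k%:R <= x ->
    ((1 + c * x) ^+ 2)^-1 <= ((1 + k%:R) ^+ 2)^-1 / c ^+ 2.
  move=> kx; have k0 := ler0n R k; rewrite -invfM -exprMn lef_pV2 ?posrE; last 2 first.
    by rewrite exprn_gt0//; nra.
    by rewrite exprn_gt0// mulr_gt0//; lra.
  by rewrite lerXn2r// ?nnegrE; nra.
rewrite -(big_mkord xpredT (fun k => ((1 + c * `|k%:R - M%:R|) ^+ 2)^-1)).
rewrite (@big_cat_nat _ _ _ M)//=; last by rewrite -addnn -addnS leq_addr.
have -> : 4 / c ^+ 2 = 2 / c ^+ 2 + 2 / c ^+ 2 by field; lra.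
have bnd n : \sum_(0 <= i < n) ((1 + i%:R) ^+ 2)^-1 / c ^+ 2 <= 2 / c ^+ 2.
  by rewrite -mulr_suml ler_wpM2r ?invr_ge0 ?sqr_ge0// sum_inv_sqr.
apply: lerD.
  rewrite big_nat_rev/= add0n; apply: le_trans (bnd M).
  rewrite !big_nat; apply: ler_sum => i /= iM; apply: H.
  rewrite natrB//.
  have -> : M%:R - i.+1%:R - M%:R = - i.+1%:R :> R by ring.
  by rewrite normrN normr_nat ler_nat.
rewrite -{1}[M]add0n big_addn; apply: le_trans (bnd _).
by apply: ler_sum => i _; apply: H; rewrite natrD addrK normr_nat.
Qed.

Lemma norm_subX_le (a b q : R) p : `|a| <= q -> `|b| <= q ->
  `|a ^+ p.+1 - b ^+ p.+1| <= p.+1%:R * q ^+ p * `|a - b|.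
Proof.
move=> aq bq; rewrite subrXX normrM mulrC ler_wpM2r//.
apply: le_trans (ler_norm_sum _ _ _) _.
apply: (@le_trans _ _ (\sum_(i < p.+1) q ^+ p)).
  apply: ler_sum => i _; rewrite /= normrM !normrX.
  have ip : (i <= p)%N by rewrite -ltnS.
  rewrite -[in leRHS](subnK ip) exprD ler_pM ?exprn_ge0//.
    by rewrite lerXn2r ?nnegrE// (le_trans _ aq).
  by rewrite lerXn2r ?nnegrE// (le_trans _ bq).
by rewrite sumr_const card_ord mulr_natl.
Qed.

(** Interpolate y |-> T y times the p-th power of [dirichlet n (x - y)], and evaluate at y = x,
    where the kernel is 1. The nodes are centred at 0 and do not depend on x, so T x and T 0 are
    expanded over the same values of T. *)
Lemma trig_reproducing n p (T : R -> R) (x : R) : trig n T ->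
  let M := (n + n * p)%N in
  let node k := (k%:R - M%:R) * (pi *+ 2 / (M.*2.+1)%:R) in
  T x = \sum_(k < M.*2.+1) T (node k) *
        (dirichlet n (x - node k) ^+ p * dirichlet M (x - node k)).
Proof.
move=> tT M node.
have tf : trig M (fun y => T y * dirichlet n (x - y) ^+ p).
  by apply: trig_ext (trigM tT (trigX p (trig_dirichlet n x))) _.
have := trig_interpolation (- M%:R * (pi *+ 2 / (M.*2.+1)%:R)) x tf.
rewrite /= subrr dirichlet0 expr1n mulr1 => ->.
by apply: eq_bigr => k _; rewrite -mulrDl [- _ + _]addrC -mulrA.
Qed.

(* Multiplying T by a power of the Dirichlet kernel keeps it a trigonometric
   polynomial of degree O(n), so interpolation reproduces it with a kernel that
   is both localized at scale 1/n and n-Lipschitz. *)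
Lemma trig_local_lipschitz (l : nat) : exists2 C : R, 0 < C &
  forall (n : nat) (T : R -> R) (B : R), (0 < n)%N -> trig n T ->
  (forall x, `|x| <= pi -> `|T x| <= B * (1 + n%:R * `|x|) ^+ l) ->
  forall x, n%:R * `|x| <= 1 -> `|T x - T 0| <= C * (n%:R * `|x|) * B.
Proof.
(* With M = n (l + 4) below, 2 M + 1 <= n (2 l + 9), so c bounds n times the node spacing from
   below. *)
pose c : R := (2 * l%:R + 9)^-1.
have l0 := ler0n R l.
have c01 : 0 < c <= 1.
  by rewrite invr_gt0 invf_le1; lra.
have K0 : 0 < (2 * l%:R + 7) * 62 ^+ l.+2 :> R.
  by apply: mulr_gt0; [lra|exact: exprn_gt0].
exists ((2 * l%:R + 7) * 62 ^+ l.+2 * (4 / c ^+ 2)).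
  by case/andP: c01 => c0 _; rewrite mulr_gt0// divr_gt0// exprn_gt0.
move=> n T B n0 tT Tbnd x nx.
have n1 : 1 <= n%:R :> R by rewrite ler1n.
have x1 : `|x| <= 1.
  by apply: le_trans nx; rewrite ler_peMl.
have pi2 := @pi_ge2 R; have pi4 : pi <= 4 :> R by have := @pihalf_lt2 R; lra.
have B0 : 0 <= B.
  have := Tbnd 0; rewrite normr0 mulr0 addr0 expr1n mulr1 => H.
  by apply: le_trans (H _) => //; exact: pi_ge0.
(* Of the l + 3 powers of the kernel, l absorb the growth of T, two make the sum over the nodes
   converge, and one is lost by taking a difference. *)
pose M := (n + n * l.+3)%N.
have ME : M%:R = n%:R * (l%:R + 4) :> R.
  by rewrite /M natrD natrM -!natr1; ring.
pose h : R := pi *+ 2 / (M.*2.+1)%:R.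
have NE : (M.*2.+1)%:R = 2 * M%:R + 1 :> R by rewrite -natr1 -mul2n natrM.
have M0 := ler0n R M.
have pi2E : pi *+ 2 = 2 * pi :> R by rewrite mulr2n; ring.
have h0 : 0 < h by rewrite divr_gt0// ?ltr0n// pmulrn_lgt0// pi_gt0.
have Mh : M%:R * h <= pi.
  rewrite /h NE pi2E mulrA ler_pdivrMr; last by lra.
  by nra.
have nh : c <= n%:R * h.
  rewrite /h NE ME mulrA ler_pdivlMr; last by nra.
  rewrite /c mulrC ler_pdivrMr; last by lra.
  rewrite pi2E.
  have : 0 <= (pi - 2) * (n%:R * (2 * l%:R + 9)) :> R by rewrite !mulr_ge0//; lra.
  by nra.
pose node k := (k%:R - M%:R) * h.
pose G u : R := dirichlet n u ^+ l.+3 * dirichlet M u.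
have -> : T x - T 0 = \sum_(k < M.*2.+1) T (node k) * (G (x - node k) - G (0 - node k)).
  rewrite (trig_reproducing l.+3 x tT) (trig_reproducing l.+3 0 tT) -sumrB.
  by apply: eq_bigr => k _; rewrite -mulrBr.
apply: le_trans (ler_norm_sum _ _ _) _.
rewrite mulrAC -mulrA [X in _ <= X]mulrC -mulrA.
rewrite (_ : _ * (_ * _) = ((2 * l%:R + 7) * 62 ^+ l.+2 * (B * (n%:R * `|x|))) * (4 / c ^+ 2)); last by ring.
apply: (@le_trans _ _ (((2 * l%:R + 7) * 62 ^+ l.+2 * (B * (n%:R * `|x|))) *
   \sum_(k < M.*2.+1) ((1 + c * `|k%:R - M%:R|) ^+ 2)^-1)); last first.
  rewrite ler_wpM2l//; last exact: sum_inv_sqr_nodes.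
  by apply: mulr_ge0; rewrite ?(ltW K0)// !mulr_ge0.
rewrite mulr_sumr; apply: ler_sum => k _.
have nodeE : `|node k| = `|k%:R - M%:R| * h by rewrite normrM (gtr0_norm h0).
have kM : `|k%:R - M%:R| <= M%:R :> R.
  have : (k <= 2 * M)%N by rewrite mul2n -ltnS.
  rewrite -(ler_nat R) natrM ler_norml => ?.
  by apply/andP; split; have := ler0n R k; lra.
have node_pi : `|node k| <= pi.
  by rewrite nodeE; apply: le_trans Mh; rewrite ler_wpM2r// ltW.
set phi := node k in nodeE node_pi *.
set Q := 1 + n%:R * `|phi|.
have Q1 : 1 <= Q by rewrite lerDl mulr_ge0.
have Q0 : 0 < Q by lra.
(* As n |x| <= 1, moving the argument from phi to x - phi changes 1 + n |phi| by a factor at most 2,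
   which turns 31 into 62. *)
have qb u : `|u| <= 5 -> Q <= 2 * (1 + n%:R * `|u|) -> `|dirichlet n u| <= 62 / Q.
  move=> u5 Qu; rewrite ler_pdivlMr//; have := dirichlet_decay n u5.
  have := normr_ge0 (dirichlet n u); set D := `|dirichlet n u|; nra.
have xphi : `|x - phi| <= 5.
  by apply: le_trans (ler_normB _ _) _; lra.
have qa : `|dirichlet n (x - phi)| <= 62 / Q.
  apply: qb => //; rewrite /Q.
  have : `|phi| <= `|x| + `|x - phi|.
    by have := ler_normB x (x - phi); rewrite opprB addrC subrK.
  have := normr_ge0 (x - phi); nra.
have qb0 : `|dirichlet n (0 - phi)| <= 62 / Q.
  by rewrite sub0r; apply: qb; rewrite normrN; rewrite -/Q; lra.
(* 2 l + 7 = (l + 3) + (l + 4): the difference of the powers, plus the Lipschitz constant M = n (l +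
   4) of the last factor. *)
have Glip : `|G (x - phi) - G (0 - phi)| <=
    (2 * l%:R + 7) * (62 / Q) ^+ l.+2 * (n%:R * `|x|).
  rewrite /G; set a := dirichlet n _ in qa *; set b := dirichlet n _ in qb0 *.
  set A := dirichlet M (x - phi); set B' := dirichlet M (0 - phi).
  have -> : a ^+ l.+3 * A - b ^+ l.+3 * B' =
     (a ^+ l.+3 - b ^+ l.+3) * A + b ^+ l.+3 * (A - B') by ring.
  apply: le_trans (ler_normD _ _) _.
  rewrite [`|_ * A|]normrM [`|_ * (A - B')|]normrM.
  have h1 := norm_subX_le l.+2 qa qb0.
  have h2 : `|A| <= 1 by exact: norm_dirichlet_le1.
  have h3 : `|a - b| <= n%:R * `|x|.
    by have := dirichlet_lipschitz n (x - phi) (0 - phi); rewrite opprB addrA subrK subr0.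
  have h4 : `|A - B'| <= M%:R * `|x|.
    by have := dirichlet_lipschitz M (x - phi) (0 - phi); rewrite opprB addrA subrK subr0.
  have h5 : `|b ^+ l.+3| <= (62 / Q) ^+ l.+2.
    rewrite normrX exprS; apply: (@le_trans _ _ (1 * `|b| ^+ l.+2)).
      by rewrite ler_wpM2r ?exprn_ge0// norm_dirichlet_le1.
    by rewrite mul1r lerXn2r ?nnegrE// divr_ge0// ltW.
  have q0 : 0 <= (62 / Q) ^+ l.+2 by rewrite exprn_ge0// divr_ge0// ltW.
  have -> : (2 * l%:R + 7) * (62 / Q) ^+ l.+2 * (n%:R * `|x|) =
     (l.+3%:R * (62 / Q) ^+ l.+2 * (n%:R * `|x|)) * 1 + (62 / Q) ^+ l.+2 * (M%:R * `|x|).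
    by rewrite ME -!natr1; ring.
  apply: lerD; apply: ler_pM => //.
  by apply: le_trans h1 _; rewrite ler_wpM2l// mulr_ge0.
rewrite normrM.
apply: le_trans (ler_pM (normr_ge0 _) (normr_ge0 _) (Tbnd _ node_pi) Glip) _.
rewrite -/Q.
have -> : B * Q ^+ l * ((2 * l%:R + 7) * (62 / Q) ^+ l.+2 * (n%:R * `|x|)) =
   (2 * l%:R + 7) * 62 ^+ l.+2 * (B * (n%:R * `|x|)) * (Q ^+ 2)^-1.
  have ql0 : Q ^+ l != 0 by rewrite expf_neq0// gt_eqF.
  have -> : (62 / Q) ^+ l.+2 = 62 ^+ l.+2 / (Q ^+ l * Q ^+ 2).
    by rewrite expr_div_n -exprD addn2.
  move: (62 ^+ l.+2) (Q ^+ l) ql0 => K q ql0.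
  by field; rewrite ql0 gt_eqF.
rewrite ler_wpM2l//; first by apply: mulr_ge0; rewrite ?(ltW K0)// !mulr_ge0.
case/andP: c01 => c0 _.
have cQ : 1 + c * `|k%:R - M%:R| <= Q.
  by rewrite lerD2l nodeE [n%:R * _]mulrCA [c * _]mulrC ler_wpM2l.
have d0 : 0 < 1 + c * `|k%:R - M%:R| by rewrite ltr_wpDr// mulr_ge0// ltW.
by rewrite lef_pV2 ?posrE ?exprn_gt0// lerXn2r// ?nnegrE ltW.
Qed.

(** The Chebyshev polynomials, from T_(j+2) = 2 X T_(j+1) - T_j; the induction carries two
    consecutive ones. *)
Lemma cos_poly j : exists2 P : {poly R}, (size P <= j.+1)%N &
  forall x, P.[cos x] = cos (j%:R * x).
Proof.
suff [P [_ [sP _ hP _]]] : exists P Q : {poly R},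
    [/\ (size P <= j.+1)%N, (size Q <= j.+2)%N,
        forall x, P.[cos x] = cos (j%:R * x) &
        forall x, Q.[cos x] = cos (j.+1%:R * x)] by exists P.
elim: j => [|j [P [Q [sP sQ hP hQ]]]].
  exists 1, 'X; split; rewrite ?size_poly1 ?size_polyX// => x.
    by rewrite hornerC mul0r cos0.
  by rewrite hornerX mul1r.
exists Q, (2 *: ('X * Q) - P); split => //.
  rewrite (leq_trans (size_polyD _ _))// geq_max size_polyN (leq_trans sP) ?andbT; last first.
    by rewrite (leq_trans (leqnSn _))// leqnSn.
  rewrite (leq_trans (size_scale_leq _ _))// (leq_trans (size_polyMleq _ _))//.
  by rewrite size_polyX.
move=> x; rewrite hornerD hornerN hornerZ hornerM hornerX hQ hP.
have -> : j.+2%:R * x = j.+1%:R * x + x by rewrite -[j.+2%:R]natr1; ring.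
have -> : j%:R * x = j.+1%:R * x - x by rewrite -[j.+1%:R]natr1; ring.
by rewrite cosB cosD; ring.
Qed.

(** Lets a power of the kernel be evaluated at an inner product, the cosine of a geodesic distance,
    where it is a polynomial. *)
Lemma dirichlet_poly M : exists2 P : {poly R}, (size P <= M.+1)%N &
  forall x, P.[cos x] = dirichlet M x.
Proof.
have H (k : 'I_M.*2.+1) : exists P : {poly R}, (size P <= M.+1)%N /\
    forall x, P.[cos x] = cos ((k%:R - M%:R) * x).
  have [kM|Mk] := leqP k M.
    have [P sP hP] := cos_poly (M - k); exists P; split.
      by rewrite (leq_trans sP)// ltnS leq_subr.
    by move=> x; rewrite hP natrB// -[RHS]cosN; congr cos; ring.
  have [P sP hP] := cos_poly (k - M); exists P; split.
    by rewrite (leq_trans sP)// ltnS leq_subLR addnn -ltnS.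
  by move=> x; rewrite hP natrB// ltnW.
have [P HP] := choice H.
exists ((2 * M%:R + 1)^-1 *: \sum_k P k).
  rewrite (leq_trans (size_scale_leq _ _))//.
  apply: (big_ind (fun p : {poly R} => (size p <= M.+1)%N)).
  - by rewrite size_poly0.
  - by move=> p q sp sq; rewrite (leq_trans (size_polyD _ _))// geq_max sp.
  - by move=> k _; case: (HP k).
move=> x; rewrite hornerZ horner_sum; congr *%R.
by apply: eq_bigr => k _; case: (HP k).
Qed.

End trigonometric_estimates.

(** * Quadrature from a doubling family of balls *)


(* The coefficients are found one point at a time: the admissible values of
   [a z] lie between the bounds given by the functions that are nonnegative on
   the other points and positive, resp. negative, at [z]. *)
Lemma positive_functional_sum (R : realType) (T : eqType) (s : seq T)
    (V : set (T -> R)) (Lam : (T -> R) -> R) : uniq s ->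
  V (fun=> 1) ->
  (forall a f g, V f -> V g -> V (fun x => a * f x + g x)) ->
  (forall a f g, V f -> V g -> Lam (fun x => a * f x + g x) = a * Lam f + Lam g) ->
  (forall f, V f -> (forall z, z \in s -> 0 <= f z) -> 0 <= Lam f) ->
  exists a : T -> R, (forall z, z \in s -> 0 <= a z) /\
    forall f, V f -> Lam f = \sum_(z <- s) a z * f z.
Proof.
move=> + V1 Vlin; elim: s Lam => [|z s IH] Lam /=.
  move=> _ lin pos; exists (fun=> 0); split => // f Vf.
  rewrite big_nil; apply/le_anti/andP; split; last exact: pos.
  have := pos _ (Vlin (- 2) _ _ Vf Vf) => /(_ (fun=> ltac:(by [])))/=.
  by rewrite lin//; lra.
move=> /andP[zs us] lin pos.
pose pos_on (f : T -> R) := forall y, y \in s -> 0 <= f y.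
(* f - (f z / g z) g vanishes at z and is nonnegative on s, since f z and g z have opposite
   signs. *)
have comb f g : V f -> V g -> pos_on f -> pos_on g -> 0 < f z -> g z < 0 ->
    Lam g / g z <= Lam f / f z.
  move=> Vf Vg pf pg fz gz.
  have Vh := Vlin (- f z / g z) _ _ Vg Vf.
  have : 0 <= Lam (fun x => (- f z / g z) * g x + f x).
    apply: pos => // y; rewrite inE => /predU1P[->|ys].
      by rewrite mulNr mulNr divfK ?lt_eqF// addNr.
    rewrite addr_ge0 ?pf// mulr_ge0 ?pg// mulNr -mulrN -invrN.
    by rewrite divr_ge0 ?ltW// oppr_gt0.
  rewrite lin// ler_pdivlMr//.
  have -> : - f z / g z * Lam g = - (Lam g / g z * f z) by ring.
  by lra.
(* The lower bounds for the coefficient at z. Adjoining 0 makes the set nonempty and its supremum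
   nonnegative; the constant function 1 bounds it from above. *)
pose S := [set x | x = 0 \/ exists2 g, V g /\ pos_on g & g z < 0 /\ x = Lam g / g z].
have L1 : 0 <= Lam (fun=> 1) by apply: pos.
have Sub x f : S x -> V f -> pos_on f -> 0 < f z -> x <= Lam f / f z.
  move=> [->|[g [Vg pg] [gz ->]]] Vf pf fz; last exact: comb.
  rewrite divr_ge0 ?(ltW fz)//; apply: pos => // y.
  by rewrite inE => /predU1P[->|/pf//]; exact: ltW.
have S0 : S !=set0 by exists 0; left.
have hS : has_sup S.
  split => //; exists (Lam (fun=> 1)) => x Sx.
  by have := Sub _ _ Sx V1; rewrite divr1; apply => //.
pose b := sup S.
have b0 : 0 <= b by apply: ub_le_sup; [case: hS|left].
have [||a [a0 aE]] := IH (fun f => Lam f - b * f z) us.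
- by move=> c f g Vf Vg; rewrite lin//; ring.
- move=> f Vf pf; rewrite subr_ge0.
  have [fz|fz|fz] := ltrgtP (f z) 0.
  + rewrite -ler_ndivrMr//; apply: ub_le_sup; first by case: hS.
    by right; exists f.
  + rewrite -ler_pdivlMr//; apply: ge_sup => // x Sx; exact: Sub.
  + rewrite fz mulr0; apply: pos => // y.
    by rewrite inE => /predU1P[->|/pf//]; rewrite fz.
exists (fun y => if y == z then b else a y); split.
  by move=> y; rewrite inE; case: eqP => //= _ /a0.
move=> f Vf; rewrite big_cons eqxx.
have -> : \sum_(y <- s) (if y == z then b else a y) * f y = \sum_(y <- s) a y * f y.
  rewrite big_seq [RHS]big_seq; apply: eq_bigr => y ys.
  by case: eqP => // yz; rewrite -yz ys in zs.
by rewrite -(aE _ Vf) addrC subrK.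
Qed.

Section peetre_maximal_function.
Context {R : realType} {T : eqType}.
Variables (X : set T) (D : T -> T -> R).

Definition peetre_max (l : nat) (f : T -> R) (z : T) : R :=
  sup [set `|f y| / (1 + D z y) ^+ l | y in X].

End peetre_maximal_function.

(** * Discrete maximal inequality for doubling masses, and the quadrature it yields *)

Section discrete_marcinkiewicz_zygmund.
Context {R : realType} {T : eqType}.
(** [D] is to be read as n times the distance, so that degree n lives at unit scale; it may vanish
    between distinct points. [W z r] is the mass of a [D]-ball and [m v] that of the part assigned
    to the node v. The diameter bound given by [Kdiam] may grow with n and enters no constant. *)
Variables (X : set T) (D : T -> T -> R).
Hypothesis D_ge0 : forall x y, X x -> X y -> 0 <= D x y.
Hypothesis D_xx : forall x, X x -> D x x = 0.
Hypothesis D_sym : forall x y, D x y = D y x.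
Hypothesis D_tri : forall x y z, X x -> X y -> X z -> D x z <= D x y + D y z.
Variable Kdiam : nat.
Hypothesis D_diam : forall x y, X x -> X y -> 1 + D x y <= 2 ^+ Kdiam.

Variables (s : nat) (W : T -> R -> R).
Hypothesis W_gt0 : forall z r, X z -> 0 < r -> 0 < W z r.
Hypothesis W_double : forall z r, X z -> 0 < r -> W z (2 * r) <= 2 ^+ s * W z r.
Hypothesis W_mono : forall z y r r', X z -> X y -> 0 < r -> D z y + r <= r' ->
  W z r <= W y r'.

Variables (Xi : seq T) (m : T -> R) (eta : R).
Hypothesis Xi_X : forall v, v \in Xi -> X v.
Hypothesis m_ge0 : forall v, v \in Xi -> 0 <= m v.
Hypothesis eta_gt0 : 0 < eta.
Hypothesis m_upper : forall z r, X z -> 0 <= r ->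
  \sum_(v <- Xi | D z v <= r) m v <= W z (r + eta).
Hypothesis m_lower : forall z r, X z -> 0 < r ->
  W z r <= \sum_(v <- Xi | D z v <= r + eta) m v.

Local Notation "'Q' x y" := (1 + D x y) (at level 10, x at level 8, y at level 8).

Let Q_ge1 x y : X x -> X y -> 1 <= Q x y.
Proof. by move=> Xx Xy; rewrite lerDl D_ge0. Qed.

Let Q_gt0 x y : X x -> X y -> 0 < Q x y.
Proof. by move=> Xx Xy; rewrite (lt_le_trans _ (Q_ge1 Xx Xy)). Qed.

Let eqW (x y : R) : x = y -> x <= y.
Proof. by move=> ->. Qed.

Lemma W_dyadic z r k : X z -> 0 < r -> W z (2 ^+ k * r) <= (2 ^+ s) ^+ k * W z r.
Proof.
move=> Xz r0; elim: k => [|k IH]; first by rewrite !expr0 !mul1r.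
rewrite exprS -mulrA; apply: le_trans (W_double Xz _) _.
  by rewrite mulr_gt0// exprn_gt0.
by rewrite [in leRHS]exprS -mulrA ler_wpM2l// exprn_ge0.
Qed.

Let dyadic_between (t : R) : 1 <= t -> exists2 k, t <= 2 ^+ k & 2 ^+ k <= 2 * t.
Proof.
move=> t1; have [K] : exists K : nat, t <= 2 ^+ K.
  exists (Num.truncn t).+1.
  apply: (@le_trans _ _ (Num.truncn t).+1%:R).
    by rewrite ltW// truncnS_gt.
  by rewrite -natrX ler_nat ltnW// ltn_expl.
elim: K => [|K IH] tK; first by exists 0%N; rewrite ?expr0 in tK *; lra.
by have [/IH//|Kt] := leP t (2 ^+ K); exists K.+1 => //; rewrite exprS; lra.
Qed.

Lemma W_growth z r t : X z -> 0 < r -> 1 <= t -> W z (t * r) <= (2 * t) ^+ s * W z r.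
Proof.
move=> Xz r0 t1; have [k tk kt] := dyadic_between t1.
apply: (@le_trans _ _ (W z (2 ^+ k * r))).
  apply: W_mono => //; first by rewrite mulr_gt0//; lra.
  by rewrite D_xx// add0r ler_wpM2r// ltW.
apply: le_trans (W_dyadic _ Xz r0) _; rewrite ler_wpM2r ?(ltW (W_gt0 _ _))//.
by rewrite exprAC lerXn2r ?nnegrE ?exprn_ge0//; lra.
Qed.

(** The term of the least k with 1 + x <= 2 ^ k already suffices, as then 2 ^ k <= 2 (1 + x). *)
Let decay_dyadic (p K : nat) (x : R) : 0 <= x -> 1 + x <= 2 ^+ K ->
  ((1 + x) ^+ p)^-1 <= \sum_(k < K.+1) 2 ^+ p / (2 ^+ k) ^+ p * (x <= 2 ^+ k)%R%:R.
Proof.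
move=> x0; have x1 : 0 < 1 + x by lra.
have pos k : 0 <= 2 ^+ p / (2 ^+ k) ^+ p :> R by rewrite divr_ge0// !exprn_ge0.
elim: K => [|K IH] xK.
  rewrite big_ord1 expr0 expr1n divr1 -[leLHS]mulr1.
  rewrite expr0 in xK; have -> : x = 0 by lra.
  by rewrite addr0 ler01 expr1n invr1 mul1r mulr1 exprn_ege1//; lra.
rewrite big_ord_recr/=; have [xK'|Kx] := leP (1 + x) (2 ^+ K).
  by apply: le_trans (IH xK') _; rewrite lerDl mulr_ge0.
apply: (@le_trans _ _ (2 ^+ p / (2 ^+ K.+1) ^+ p * (x <= 2 ^+ K.+1)%R%:R)); last first.
  by rewrite lerDr sumr_ge0// => k _; rewrite mulr_ge0.
have -> : x <= 2 ^+ K.+1 by lra.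
have K0 : 0 < 2 ^+ K :> R by rewrite exprn_gt0.
rewrite mulr1 exprS exprMn invfM mulVKf ?expf_neq0//.
by rewrite lef_pV2 ?posrE ?exprn_gt0// lerXn2r ?nnegrE ?ltW.
Qed.

Let geometric_le2 n : \sum_(k < n) (2 ^+ k)^-1 <= 2 :> R.
Proof.
have -> : \sum_(k < n) (2 ^+ k)^-1 = 2 - 2 / 2 ^+ n :> R.
  elim: n => [|n IH]; first by rewrite big_ord0 expr0 divr1 subrr.
  rewrite big_ord_recr/= IH exprS; field.
  by rewrite expf_neq0.
by rewrite gerBl divr_ge0// exprn_ge0.
Qed.

(** The layer D z v <= 2 ^ k has mass at most 2 ^ (s (k + 1)) [W z 1], because eta <= 1, and weight
    of order 2 ^ (- k (s + 1)); the extra power leaves a geometric series. *)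
Lemma sum_mass_decay z : eta <= 1 -> X z ->
  \sum_(v <- Xi) m v / Q z v ^+ s.+1 <= 2 ^+ (s.*2 + 2) * W z 1.
Proof.
move=> eta1 Xz.
pose c k : R := 2 ^+ s.+1 / (2 ^+ k) ^+ s.+1.
have c0 k : 0 <= c k by rewrite divr_ge0// !exprn_ge0.
apply: (@le_trans _ _ (\sum_(v <- Xi) \sum_(k < Kdiam.+1)
    c k * (m v * (D z v <= 2 ^+ k)%R%:R))).
  rewrite big_seq [leRHS]big_seq; apply: ler_sum => v vXi.
  apply: (@le_trans _ _ (m v * \sum_(k < Kdiam.+1) c k * (D z v <= 2 ^+ k)%R%:R)).
    rewrite ler_wpM2l ?m_ge0//; apply: decay_dyadic; [|apply: D_diam] => //.
    - by apply: D_ge0 => //; exact: Xi_X.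
    - exact: Xi_X.
  by rewrite mulr_sumr; apply: ler_sum => k _; rewrite mulrCA.
rewrite exchange_big/=.
apply: (@le_trans _ _ (\sum_(k < Kdiam.+1) (2 ^+ (s.*2 + 1) * W z 1) * (2 ^+ k)^-1)).
  apply: ler_sum => k _; rewrite -mulr_sumr.
  have K0 : 0 < 2 ^+ k :> R by rewrite exprn_gt0.
  apply: (@le_trans _ _ (c k * ((2 ^+ s) ^+ k.+1 * W z 1))).
    rewrite ler_wpM2l//; apply: (@le_trans _ _ (W z (2 ^+ k + eta))).
      apply: le_trans (m_upper Xz (ltW K0)).
      by rewrite [leRHS]big_mkcond/=; apply: ler_sum => v _; case: ifP => _; rewrite ?mulr1 ?mulr0.
    apply: le_trans (W_dyadic k.+1 Xz ltr01); apply: W_mono => //; first by rewrite addr_gt0.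
    have : 1 <= 2 ^+ k :> R by rewrite exprn_ege1//; lra.
    by rewrite D_xx// mulr1 add0r exprS; move: (2 ^+ k) => t t1; lra.
  apply: eqW; rewrite /c.
  have -> : (2 ^+ s) ^+ k.+1 = 2 ^+ s * (2 ^+ k) ^+ s :> R.
    by rewrite exprS -!exprM mulnC.
  have -> : 2 ^+ (s.*2 + 1) = 2 * (2 ^+ s * 2 ^+ s) :> R.
    by rewrite addn1 exprS -addnn exprD.
  rewrite !exprS; have K1 := lt0r_neq0 K0.
  have := expf_neq0 s K1; move: (2 ^+ k) K1 (2 ^+ s) ((2 ^+ k) ^+ s) => t t0 a b b0.
  by field; rewrite t0 b0.
rewrite -mulr_sumr [leRHS](_ : _ = (2 ^+ (s.*2 + 1) * W z 1) * 2); last first.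
  by rewrite addn2 addn1 exprS; ring.
rewrite ler_wpM2l ?geometric_le2//.
by rewrite mulr_ge0 ?exprn_ge0// ltW// W_gt0.
Qed.

Variables (l : nat) (C0 eps : R).
Hypothesis lE : l = (3 * s + 1)%N.
Hypothesis C0_gt0 : 0 < C0.
Hypothesis eps_gt0 : 0 < eps.
Hypothesis eps_le1 : eps <= 1.
Hypothesis C0eps : C0 * eps <= 4^-1.
Hypothesis eta_eps : eta <= eps / 2.

(** The factors are 2 for a near-maximizer y, 2 for |f y| <= 2 |f v| on the eps-ball, 2 ^ (2 s + 1)
    for 1 + D z v <= 2 (1 + D z y), and (4 / eps) ^ s for doubling. *)
Let A := 2 ^+ (2 * s + 3) * (4 / eps) ^+ s.

Section one_function.
Variables (f : T -> R) (Bf : R).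
Hypothesis f_bounded : forall y, X y -> `|f y| <= Bf.
Hypothesis f_lipschitz : forall y v, X y -> X v -> D y v <= 1 ->
  `|f v - f y| <= C0 * D y v * peetre_max X D l f y.

Local Notation fstar := (peetre_max X D l f).

Let f_ub z : X z -> has_ubound [set `|f y| / (1 + D z y) ^+ l | y in X].
Proof.
move=> Xz; exists Bf => _ [y Xy <-]; apply: le_trans (f_bounded Xy).
rewrite ler_pdivrMr; last by rewrite exprn_gt0 ?Q_gt0.
by rewrite ler_peMr// exprn_ege1// Q_ge1.
Qed.

Lemma peetre_max_ub z y : X z -> X y -> `|f y| <= fstar z * Q z y ^+ l.
Proof.
move=> Xz Xy; rewrite -ler_pdivrMr; last by rewrite exprn_gt0 ?Q_gt0.
by apply: ub_le_sup; [exact: f_ub|exists y].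
Qed.

Lemma peetre_max_ge0 z : X z -> 0 <= fstar z.
Proof.
move=> Xz; apply: (@le_trans _ _ (`|f z| / (Q z z) ^+ l)).
  by rewrite divr_ge0// exprn_ge0// ltW// Q_gt0.
by apply: ub_le_sup; [exact: f_ub|exists z].
Qed.

Lemma peetre_max_near z : X z -> exists2 y, X y & fstar z * Q z y ^+ l <= 2 * `|f y|.
Proof.
move=> Xz; have := peetre_max_ge0 Xz; rewrite le_eqVlt => /predU1P[z0|z0].
  by exists z => //; rewrite -z0 mul0r mulr_ge0.
have hs : has_sup [set `|f y| / (1 + D z y) ^+ l | y in X].
  by split; [exists (`|f z| / (1 + D z z) ^+ l), z|exact: f_ub].
have z2 : 0 < fstar z / 2 by rewrite divr_gt0.
have [_ [y Xy <-]] := sup_adherent z2 hs.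
rewrite -/(fstar z) ltr_pdivlMr; last by rewrite exprn_gt0 ?Q_gt0.
move=> H; exists y => //; move: H; set q := _ ^+ _; lra.
Qed.

(** By the triangle inequality 1 + D is submultiplicative, so the maximal function at y is at most
    (1 + D z y) ^ l times that at z. *)
Let near_max z y : X z -> X y -> fstar z * Q z y ^+ l <= 2 * `|f y| ->
  fstar y <= 2 * `|f y|.
Proof.
move=> Xz Xy H; apply: ge_sup.
  by exists (`|f y| / (Q y y) ^+ l), y.
move=> _ [v Xv <-]; apply: le_trans H.
have q0 := Q_gt0 Xy Xv; rewrite ler_pdivrMr ?exprn_gt0//.
apply: le_trans (peetre_max_ub Xz Xv) _.
rewrite -mulrA ler_wpM2l ?peetre_max_ge0// -exprMn.
have := D_tri Xz Xy Xv; have := D_ge0 Xz Xy; have := D_ge0 Xy Xv.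
have := D_ge0 Xz Xv => *.
by rewrite lerXn2r ?nnegrE ?mulr_ge0//; nra.
Qed.

(* If y nearly attains the supremum defining [fstar z], then [fstar y] is at most
   2 |f y|, so by the Lipschitz hypothesis |f| >= |f y| / 2 on the eps-ball at y
   and |f y| is controlled by an average of |f| there. *)
Lemma peetre_max_pointwise z : X z ->
  W z 1 * fstar z <= A * \sum_(v <- Xi) m v * `|f v| / Q z v ^+ (2 * s + 1).
Proof.
move=> Xz; have [y Xy Hy] := peetre_max_near Xz.
have fy := near_max Xz Xy Hy.
have q0 := Q_gt0 Xz Xy; have q1 := Q_ge1 Xz Xy.
have e0 := eps_gt0; have e1 := eps_le1; have et0 := eta_gt0; have ete := eta_eps.
have e2 : 0 < eps / 2 by rewrite divr_gt0.
(* On the eps-ball f varies by at most C0 eps [fstar y] <= (1/4) (2 |f y|) = |f y| / 2. *)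
have fv v : X v -> D y v <= eps -> `|f y| <= 2 * `|f v|.
  move=> Xv yv; have := f_lipschitz Xy Xv (le_trans yv eps_le1).
  have d0 := D_ge0 Xy Xv; have f0 := peetre_max_ge0 Xy.
  have : C0 * D y v * fstar y <= 4^-1 * (2 * `|f y|).
    apply: ler_pM => //; first by rewrite mulr_ge0// ltW.
    by apply: le_trans C0eps; rewrite ler_wpM2l// ltW.
  have := ler_normB (f v) (f v - f y); rewrite opprB addrC subrK.
  by lra.
(* The unit ball at z lies in the ball of radius 1 + D z y at y; shrinking that to radius eps / 2
   costs (4 (1 + D z y) / eps) ^ s. *)
have Wz : W z 1 <= (4 / eps) ^+ s * Q z y ^+ s * W y (eps / 2).
  apply: (@le_trans _ _ (W y (Q z y * (2 / eps) * (eps / 2)))).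
    apply: W_mono => //; apply: eqW.
    by field; rewrite gt_eqF.
  apply: le_trans (W_growth Xy e2 _) _.
    have : 1 <= 2 / eps by rewrite ler_pdivlMr//; lra.
    by move=> ?; rewrite mulr_ege1.
  by apply: eqW; rewrite -exprMn; congr (_ ^+ _ * _); field; rewrite gt_eqF.
have Wm : W y (eps / 2) <= \sum_(v <- Xi | D y v <= eps) m v.
  apply: (@le_trans _ _ (W y (eps - eta))).
    by apply: W_mono => //; rewrite D_xx// add0r; lra.
  by have := @m_lower y (eps - eta) Xy; rewrite subrK; apply; lra.
have M0 : 0 <= \sum_(v <- Xi | D y v <= eps) m v.
  by rewrite big_seq_cond sumr_ge0// => v /andP[/m_ge0].
have ed0 : 0 <= (4 / eps) ^+ s by rewrite exprn_ge0// divr_ge0// ltW.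
have Qs0 : 0 < Q z y ^+ s by rewrite exprn_gt0.
have Ql0 : 0 < Q z y ^+ (2 * s + 1) by rewrite exprn_gt0.
have lS : Q z y ^+ l = Q z y ^+ s * Q z y ^+ (2 * s + 1).
  by rewrite -exprD lE; congr (_ ^+ _); rewrite addnA -mulSn.
apply: (@le_trans _ _ ((4 / eps) ^+ s * Q z y ^+ s *
    (\sum_(v <- Xi | D y v <= eps) m v) * (2 * `|f y| / Q z y ^+ l))).
  apply: ler_pM => //; first by rewrite ltW// W_gt0.
  - exact: peetre_max_ge0.
  - apply: le_trans Wz _; rewrite ler_wpM2l// mulr_ge0// ltW//.
  - by rewrite ler_pdivlMr// lS mulr_gt0.
have -> : (4 / eps) ^+ s * Q z y ^+ s * (\sum_(v <- Xi | D y v <= eps) m v) *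
    (2 * `|f y| / Q z y ^+ l) =
    (4 / eps) ^+ s * (2 * \sum_(v <- Xi | D y v <= eps) m v * (`|f y| / Q z y ^+ (2 * s + 1))).
  rewrite -mulr_suml lS; move: (Q z y ^+ s) Qs0 (Q z y ^+ (2 * s + 1)) Ql0 => a a0 b b0.
  by field; rewrite !gt_eqF.
rewrite /A [X in _ <= X * _]mulrC -[leRHS]mulrA ler_wpM2l//.
rewrite (_ : (2 * s + 3 = 1 + (2 * s + 2))%N); last by rewrite addnCA.
rewrite [in leRHS]exprD expr1 -[leRHS]mulrA ler_wpM2l// mulr_sumr big_mkcond/=.
rewrite big_seq [leRHS]big_seq; apply: ler_sum => v vXi.
have Xv := Xi_X vXi; have mv := m_ge0 vXi.
have qv0 := Q_gt0 Xz Xv.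
have qvl : 0 < Q z v ^+ (2 * s + 1) by rewrite exprn_gt0.
case: ifPn => yv; last by rewrite mulr_ge0 ?exprn_ge0// divr_ge0 ?mulr_ge0// ltW.
rewrite -mulrA [leRHS]mulrCA ler_wpM2l//.
rewrite ler_pdivrMr//.
have H1 := fv _ Xv yv.
have H2 : Q z v ^+ (2 * s + 1) <= 2 ^+ (2 * s + 1) * Q z y ^+ (2 * s + 1).
  have : Q z v <= 2 * Q z y by have := D_tri Xz Xy Xv; lra.
  by rewrite -exprMn; apply: lerXn2r; rewrite nnegrE ?mulr_ge0// ltW.
rewrite [X in _ <= X * _]mulrA [leRHS]mulrAC ler_pdivlMr// (_ : (2 * s + 2 = (2 * s + 1).+1)%N); last by rewrite addn2 addn1.
rewrite [in leRHS]exprS (_ : 2 * _ * _ * _ = (2 * `|f v|) * (2 ^+ (2 * s + 1) * Q z y ^+ (2 * s + 1))); last by ring.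
by rewrite ler_pM// ltW.
Qed.

(** After the pointwise bound the two sums are exchanged. Replacing 1 / [W z 1] by 1 / [W v 1] uses
    s of the 2 s + 1 powers of decay and a factor 2 ^ s; the other s + 1 are summed over z by
    [sum_mass_decay]. *)
Lemma sum_peetre_max : \sum_(z <- Xi) m z * fstar z <=
  2 ^+ (3 * s + 2) * A * \sum_(v <- Xi) m v * `|f v|.
Proof.
have eta1 : eta <= 1 by have := eps_le1; have := eta_eps; lra.
have A0 : 0 <= A by rewrite mulr_ge0 ?exprn_ge0// divr_ge0// ltW.
apply: (@le_trans _ _ (\sum_(z <- Xi) m z / W z 1 *
    (A * \sum_(v <- Xi) m v * `|f v| / Q z v ^+ (2 * s + 1)))).
  rewrite big_seq [leRHS]big_seq; apply: ler_sum => z /[dup] zXi /Xi_X Xz.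
  rewrite -mulrA ler_wpM2l ?m_ge0// ler_pdivlMl ?W_gt0//.
  exact: peetre_max_pointwise.
rewrite [leRHS]mulrAC [leRHS]mulrC.
under eq_bigr do rewrite mulrCA mulr_sumr.
rewrite -mulr_sumr ler_wpM2l// exchange_big/= mulr_sumr.
rewrite big_seq [leRHS]big_seq; apply: ler_sum => v /[dup] vXi /Xi_X Xv.
have Wv := W_gt0 Xv ltr01.
apply: (@le_trans _ _ (\sum_(z <- Xi) (m v * `|f v| * (2 ^+ s / W v 1)) * (m z / Q v z ^+ s.+1))).
  rewrite big_seq [leRHS]big_seq; apply: ler_sum => z /[dup] zXi /Xi_X Xz.
  have Wz := W_gt0 Xz ltr01; have q0 := Q_gt0 Xv Xz; have q1 := Q_ge1 Xv Xz.
  rewrite [D z v]D_sym (_ : (2 * s + 1 = s + s.+1)%N); last by rewrite mul2n -addnn addn1 addnS.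
  rewrite exprD.
  have H : (W z 1)^-1 <= 2 ^+ s * Q v z ^+ s / W v 1.
    rewrite ler_pdivlMr// mulrC ler_pdivrMr// -exprMn.
    have := W_growth Xz ltr01 q1; apply: le_trans.
    by rewrite mulr1; apply: W_mono => //; rewrite addrC.
  have Qs : 0 < Q v z ^+ s by rewrite exprn_gt0.
  have QS : 0 < Q v z ^+ s.+1 by rewrite exprn_gt0.
  have -> : m v * `|f v| * (2 ^+ s / W v 1) * (m z / Q v z ^+ s.+1) =
    m z * (2 ^+ s * Q v z ^+ s / W v 1) * (m v * `|f v| / (Q v z ^+ s * Q v z ^+ s.+1)).
    move: (2 ^+ s) (Q v z ^+ s) (Q v z ^+ s.+1) Qs QS => a b c b0 c0.
    by field; rewrite !gt_eqF.
  rewrite ler_wpM2r//; first by rewrite divr_ge0 ?mulr_ge0 ?m_ge0// ltW.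
  by rewrite ler_wpM2l ?m_ge0.
rewrite -mulr_sumr [leRHS]mulrC -!mulrA ler_wpM2l ?m_ge0// ler_wpM2l//.
rewrite (_ : (3 * s + 2 = s + (s.*2 + 2))%N); last by rewrite addnA -mul2n -mulSn.
rewrite [in leRHS]exprD ler_wpM2l ?exprn_ge0//.
by rewrite ler_pdivrMl// mulrC; exact: sum_mass_decay.
Qed.

End one_function.

Variables (V : set (T -> R)) (I : (T -> R) -> R) (CK : R).
Hypothesis Xi_uniq : uniq Xi.
Hypothesis V1 : V (fun=> 1).
Hypothesis V_linear : forall a f g, V f -> V g -> V (fun x => a * f x + g x).
Hypothesis I_linear : forall a f g, V f -> V g ->
  I (fun x => a * f x + g x) = a * I f + I g.
Hypothesis V_bounded : forall f, V f -> exists B, forall y, X y -> `|f y| <= B.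
Hypothesis V_lipschitz : forall f, V f -> forall y v, X y -> X v -> D y v <= 1 ->
  `|f v - f y| <= C0 * D y v * peetre_max X D l f y.
Hypothesis I_oscillation : forall f (h : T -> R), V f ->
  (forall z y, z \in Xi -> X y -> D z y <= eta -> `|f y - f z| <= h z) ->
  `|I f - \sum_(z <- Xi) m z * f z| <= \sum_(z <- Xi) m z * h z.
Hypothesis V_kernel : forall z, X z -> exists2 K, V K &
  [/\ forall v, X v -> 0 <= K v, 1 <= K z &
      forall v, X v -> K v <= CK / (1 + D z v) ^+ s.+1].
Hypothesis eta_small : C0 * eta * (2 ^+ (3 * s + 2) * A) <= 2^-1.

Lemma I_sum_close f : V f ->
  `|I f - \sum_(z <- Xi) m z * f z| <= 2^-1 * \sum_(v <- Xi) m v * `|f v|.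
Proof.
move=> Vf; have [B fB] := V_bounded Vf; have fL := V_lipschitz Vf.
have e1 := eps_le1; have ee := eta_eps.
have S0 : 0 <= \sum_(v <- Xi) m v * `|f v|.
  by rewrite big_seq sumr_ge0// => v vXi; rewrite mulr_ge0// m_ge0.
apply: (@le_trans _ _ (\sum_(z <- Xi) m z * (C0 * eta * peetre_max X D l f z))).
  apply: I_oscillation => // z y /[dup] zXi /Xi_X Xz Xy zy.
  apply: le_trans (fL _ _ Xz Xy _) _; first by apply: le_trans zy _; lra.
  by rewrite ler_wpM2r ?(peetre_max_ge0 fB)// ler_wpM2l// ltW.
under eq_bigr do rewrite mulrCA.
rewrite -mulr_sumr; apply: (@le_trans _ _ (C0 * eta *
    (2 ^+ (3 * s + 2) * A * \sum_(v <- Xi) m v * `|f v|))).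
  by rewrite ler_wpM2l ?(sum_peetre_max fB)// mulr_ge0// ltW.
by rewrite mulrA ler_wpM2r.
Qed.

Theorem positive_quadrature : exists a : T -> R,
  (forall f, V f -> I f = \sum_(z <- Xi) a z * f z) /\
  forall z, z \in Xi -> m z / 2 <= a z <=
    2 * CK * 2 ^+ (s.*2 + 2) * (2 / eta) ^+ s * W z eta.
Proof.
pose Lam f := I f - 2^-1 * \sum_(z <- Xi) m z * f z.
have [||b [b0 bE]] := positive_functional_sum Xi_uniq V1 V_linear (Lam := Lam).
- move=> a f g Vf Vg; rewrite /Lam I_linear//.
  have -> : \sum_(z <- Xi) m z * (a * f z + g z) =
      a * \sum_(z <- Xi) m z * f z + \sum_(z <- Xi) m z * g z.
    by rewrite mulr_sumr -big_split/=; apply: eq_bigr => z _; ring.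
  by ring.
- move=> f Vf f0; have := I_sum_close Vf.
  have -> : \sum_(v <- Xi) m v * `|f v| = \sum_(v <- Xi) m v * f v.
    by rewrite big_seq [RHS]big_seq; apply: eq_bigr => v vXi; rewrite ger0_norm ?f0.
  by rewrite /Lam ler_norml => /andP[+ _]; set S := \sum_(_ <- _) _; lra.
pose a z := b z + 2^-1 * m z.
have aE f : V f -> I f = \sum_(z <- Xi) a z * f z.
  move=> Vf; have := bE f Vf; rewrite /Lam => /eqP; rewrite subr_eq => /eqP ->.
  by rewrite mulr_sumr -big_split/=; apply: eq_bigr => z _; rewrite /a; ring.
have a0 z : z \in Xi -> 0 <= a z.
  by move=> zXi; rewrite addr_ge0 ?b0// mulr_ge0// m_ge0.
exists a; split => // z zXi; have Xz := Xi_X zXi; apply/andP; split.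
  by rewrite /a mulrC lerDr b0.
have [K VK [K0 K1 Kd]] := V_kernel Xz.
have Kz := Kd _ Xz; have Wz := W_gt0 Xz ltr01.
have CK0 : 0 <= CK.
  by move: Kz; rewrite D_xx// addr0 expr1n divr1; lra.
apply: (@le_trans _ _ (I K)).
  rewrite aE// (big_rem z)//=; apply: (@le_trans _ _ (a z * K z)).
    by rewrite ler_peMr// a0.
  rewrite lerDl big_seq sumr_ge0// => v /mem_rem vXi.
  by rewrite mulr_ge0 ?a0// K0//; exact: Xi_X.
have := I_sum_close VK.
have -> : \sum_(v <- Xi) m v * `|K v| = \sum_(v <- Xi) m v * K v.
  rewrite big_seq [RHS]big_seq; apply: eq_bigr => v vXi.
  by rewrite ger0_norm// K0//; exact: Xi_X.
have SK : \sum_(v <- Xi) m v * K v <= CK * (2 ^+ (s.*2 + 2) * W z 1).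
  apply: (@le_trans _ _ (CK * \sum_(v <- Xi) m v / (1 + D z v) ^+ s.+1)).
    rewrite mulr_sumr big_seq [leRHS]big_seq; apply: ler_sum => v vXi.
    by rewrite mulrCA ler_wpM2l ?m_ge0// Kd//; exact: Xi_X.
  rewrite ler_wpM2l// sum_mass_decay//.
  by have := eps_le1; have := eta_eps; lra.
rewrite ler_norml => /andP[_].
(* Descending from radius 1 to eta by doubling brings in the power of 2 / eta, hence the dependence
   of the upper constant on delta. *)
have W1 : W z 1 <= (2 / eta) ^+ s * W z eta.
  have := W_growth Xz eta_gt0 (t := eta^-1); rewrite mulVf ?gt_eqF//; apply.
  by rewrite invf_ge1//; have := eps_le1; have := eta_eps; lra.
have S0 : 0 <= \sum_(v <- Xi) m v * K v.
  by rewrite big_seq sumr_ge0// => v vXi; rewrite mulr_ge0 ?m_ge0// K0//; exact: Xi_X.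
have : CK * (2 ^+ (s.*2 + 2) * W z 1) <=
    CK * (2 ^+ (s.*2 + 2) * ((2 / eta) ^+ s * W z eta)).
  by rewrite !ler_wpM2l ?exprn_ge0.
have -> : 2 * CK * 2 ^+ (s.*2 + 2) * (2 / eta) ^+ s * W z eta =
  2 * (CK * (2 ^+ (s.*2 + 2) * ((2 / eta) ^+ s * W z eta))) by ring.
move: SK S0; set S := \sum_(v <- Xi) _.
set u := CK * _; set v := CK * _; lra.
Qed.

End discrete_marcinkiewicz_zygmund.

(** * The hyperboloid as a hemisphere *)


Section arccosine.
Context {R : realType}.
Implicit Types x c r : R.

Lemma ler_cos : {in `[0, pi] &, {mono (@cos R) : x y /~ y <= x}}.
Proof. by move=> x y xI yI; rewrite !leNgt ltr_cos. Qed.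

Lemma acos_in c : -1 <= c <= 1 -> acos c \in `[0, (pi : R)].
Proof. by move=> c1; rewrite in_itv/= acos_ge0// acos_lepi. Qed.

Lemma acos_le c r : -1 <= c <= 1 -> 0 <= r <= pi -> (acos c <= r) = (cos r <= c).
Proof.
move=> c1 r0; rewrite -[in RHS](@acosK _ c) ?in_itv//=.
by rewrite ler_cos ?acos_in// in_itv.
Qed.

End arccosine.

Section inner_product.
Context {R : realType} {d : nat}.
Local Notation point := ('rV[R]_d * R)%type.
Implicit Types (u v w : point) (x y : 'rV[R]_d).

Lemma dotpC x y : dotp x y = dotp y x.
Proof. by apply: eq_bigr => i _; rewrite mulrC. Qed.

Lemma dotp_ge0 x : 0 <= dotp x x.
Proof. by apply: sumr_ge0 => i _; rewrite -expr2 sqr_ge0. Qed.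

Lemma dotp_eq0 x : dotp x x = 0 -> x = 0.
Proof.
move=> /eqP; rewrite psumr_eq0; last by move=> i _; rewrite -expr2 sqr_ge0.
move=> /allP x0; apply/rowP => i; rewrite mxE.
by have := x0 i (mem_index_enum _); rewrite /= mulf_eq0 orbb => /eqP.
Qed.

Definition ip u v : R := dotp u.1 v.1 + u.2 * v.2.

Lemma ipC u v : ip u v = ip v u.
Proof. by rewrite /ip dotpC mulrC. Qed.

Lemma ip_ge0 u : 0 <= ip u u.
Proof. by rewrite addr_ge0 ?dotp_ge0// -expr2 sqr_ge0. Qed.

Lemma ip_eq0 u : ip u u = 0 -> u = 0.
Proof.
move=> /eqP; rewrite paddr_eq0 ?dotp_ge0 -?expr2 ?sqr_ge0// sqrf_eq0.
by case: u => x a /= /andP[/eqP/dotp_eq0 -> /eqP ->].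
Qed.

Lemma ipDl u v w (a b : R) : ip (a *: u + b *: v) w = a * ip u w + b * ip v w.
Proof.
rewrite /ip /dotp/=.
have -> : \sum_(i < d) (a *: u.1 + b *: v.1) ord0 i * w.1 ord0 i =
  a * \sum_(i < d) u.1 ord0 i * w.1 ord0 i + b * \sum_(i < d) v.1 ord0 i * w.1 ord0 i.
  by rewrite !mulr_sumr -big_split/=; apply: eq_bigr => i _; rewrite !mxE; ring.
by rewrite /GRing.scale/=; ring.
Qed.

Lemma ipDr u v w (a b : R) : ip w (a *: u + b *: v) = a * ip w u + b * ip w v.
Proof. by rewrite ipC ipDl !(ipC w). Qed.

Lemma cauchy_schwarz u v : ip u v ^+ 2 <= ip u u * ip v v.
Proof.
have q a b : 0 <= a ^+ 2 * ip u u + 2 * a * b * ip u v + b ^+ 2 * ip v v.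
  have := ip_ge0 (a *: u + b *: v); rewrite ipDl !ipDr (ipC v u).
  by move=> /le_trans; apply; rewrite le_eqVlt; apply/orP; left; apply/eqP; ring.
have := ip_ge0 v; rewrite le_eqVlt => /predU1P[v0|v0].
  rewrite -v0 mulr0 leNgt; apply/negP => uv.
  have uv0 : ip u v != 0 by rewrite -sqrf_eq0 gt_eqF.
  (* When [ip v v] is 0 the form is affine in b, and this b gives it the value -1. *)
  have := q 1 (- (ip u u + 1) / (2 * ip u v)); rewrite -v0.
  have -> : 1 ^+ 2 * ip u u + 2 * 1 * (- (ip u u + 1) / (2 * ip u v)) * ip u v +
    (- (ip u u + 1) / (2 * ip u v)) ^+ 2 * 0 = -1 by field.
  by rewrite oppr_ge0 ler10.
have := q (ip v v) (- ip u v).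
have -> : ip v v ^+ 2 * ip u u + 2 * ip v v * - ip u v * ip u v + (- ip u v) ^+ 2 * ip v v
  = ip v v * (ip u u * ip v v - ip u v ^+ 2) by ring.
by rewrite pmulr_rge0// subr_ge0.
Qed.

Lemma ip_unit_bounds u v : ip u u = 1 -> ip v v = 1 -> -1 <= ip u v <= 1.
Proof.
move=> u1 v1; have := cauchy_schwarz u v; rewrite u1 v1 mulr1 => H.
by rewrite -ler_norml -(expr_le1 (n := 2))// real_normK ?num_real.
Qed.

(* The components of [u] and [w] orthogonal to [v] have norms [sin] of the
   angles to [v], so [cos (angle u w) >= cos (angle u v + angle v w)]. *)
Lemma angle_triangle u v w : ip u u = 1 -> ip v v = 1 -> ip w w = 1 ->
  acos (ip u w) <= acos (ip u v) + acos (ip v w).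
Proof.
move=> u1 v1 w1.
have uv := ip_unit_bounds u1 v1; have vw := ip_unit_bounds v1 w1.
have uw := ip_unit_bounds u1 w1.
have [pi_le|lt_pi] := leP pi (acos (ip u v) + acos (ip v w)).
  by apply: le_trans pi_le; exact: acos_lepi.
rewrite acos_le//; last by rewrite addr_ge0 ?acos_ge0//= ltW.
rewrite cosD !acosK ?in_itv//= !sin_acos//.
set a := ip u v in uv *; set b := ip v w in vw *.
have := cauchy_schwarz (1 *: u + (- a) *: v) (1 *: w + (- b) *: v).
rewrite !ipDl !ipDr u1 v1 w1 -/a -/b (ipC v u) (ipC w v) -/a -/b.
have -> : 1 * (1 * ip u w + - b * a) + - a * (1 * b + - b * 1) = ip u w - a * b by ring.
have -> : (1 * (1 * 1 + - a * a) + - a * (1 * a + - a * 1)) *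
  (1 * (1 * 1 + - b * b) + - b * (1 * b + - b * 1)) = (1 - a ^+ 2) * (1 - b ^+ 2) by ring.
have a0 : 0 <= 1 - a ^+ 2.
  by rewrite subr_ge0 -real_normK ?num_real// expr_le1// ler_norml.
rewrite -sqrtrM// => H.
have := ler_wsqrtr H; rewrite sqrtr_sqr ler_norml => /andP[+ _].
lra.
Qed.

End inner_product.

Section double_hyperboloid.
Context {R : realType} {d : nat} (rho : R).
Hypothesis rho_ge0 : 0 <= rho.
Local Notation point := ('rV[R]_d * R)%type.
Local Notation X := (@X0 R d rho).
Local Notation dist := (@dist_X0 R d rho).
Implicit Types (z y v u : point).

(* [to_sphere] maps each part of X0 onto the upper unit hemisphere of R^(d+1), where
   [dist_X0] is the geodesic distance; [from_sphere] is the inverse map onto the part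
   [t >= 0]. *)
Definition to_sphere z : point := (z.1, Num.sqrt (1 + rho ^+ 2 - z.2 ^+ 2)).
Definition from_sphere u : point := (u.1, Num.sqrt (rho ^+ 2 + dotp u.1 u.1)).

Lemma X0_dotp z : X z -> dotp z.1 z.1 = z.2 ^+ 2 - rho ^+ 2.
Proof. by case; rewrite /enorm sqr_sqrtr// dotp_ge0. Qed.

Lemma X0_height z : X z -> z.2 ^+ 2 <= rho ^+ 2 + 1.
Proof.
move=> [_ /andP[_]]; rewrite -ler_sqr ?nnegrE ?sqrtr_ge0// real_normK ?num_real//.
by rewrite sqr_sqrtr// addr_ge0 ?sqr_ge0.
Qed.

Lemma to_sphere_unit z : X z -> ip (to_sphere z) (to_sphere z) = 1.
Proof.
move=> Xz; rewrite /ip/= X0_dotp// -expr2 sqr_sqrtr; first by ring.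
by have := X0_height Xz; lra.
Qed.

Lemma distE z y : dist z y = acos (ip (to_sphere z) (to_sphere y)).
Proof. by []. Qed.

Lemma dist_bounds z y : X z -> X y -> 0 <= dist z y <= pi.
Proof.
move=> Xz Xy; have := ip_unit_bounds (to_sphere_unit Xz) (to_sphere_unit Xy) => H.
by rewrite distE acos_ge0// acos_lepi.
Qed.

Lemma dist_sym z y : dist z y = dist y z.
Proof. by rewrite !distE ipC. Qed.

Lemma dist_xx z : X z -> dist z z = 0.
Proof. by move=> Xz; rewrite distE to_sphere_unit// acos1. Qed.

Lemma dist_triangle z y v : X z -> X y -> X v -> dist z v <= dist z y + dist y v.
Proof. by move=> Xz Xy Xv; rewrite !distE; apply: angle_triangle; exact: to_sphere_unit. Qed.

Lemma dist_le z y r : X z -> X y -> 0 <= r <= pi ->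
  (dist z y <= r) = (cos r <= ip (to_sphere z) (to_sphere y)).
Proof.
by move=> Xz Xy r0; rewrite distE acos_le//; apply: ip_unit_bounds; exact: to_sphere_unit.
Qed.

Lemma unit_dotp_le1 u : ip u u = 1 -> dotp u.1 u.1 = 1 - u.2 ^+ 2.
Proof. by rewrite /ip -expr2; lra. Qed.

Lemma from_sphere_X0 u : ip u u = 1 -> X (from_sphere u).
Proof.
move=> u1; have e := unit_dotp_le1 u1; have d0 := dotp_ge0 u.1.
have s0 : 0 <= rho ^+ 2 + dotp u.1 u.1 by rewrite addr_ge0 ?sqr_ge0.
split=> /=; first by rewrite /enorm !sqr_sqrtr//; ring.
rewrite /heights/= ger0_norm ?sqrtr_ge0//; apply/andP; split.
  by rewrite -{1}(ger0_norm rho_ge0) -sqrtr_sqr ler_wsqrtr// lerDl.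
by rewrite ler_wsqrtr// e; have := sqr_ge0 u.2; lra.
Qed.

(** [from_sphere] depends on [u.1] alone, so a point below the equator comes back reflected. *)
Lemma to_from_sphere u : ip u u = 1 -> to_sphere (from_sphere u) = (u.1, `|u.2|).
Proof.
move=> u1; rewrite /to_sphere/= sqr_sqrtr ?addr_ge0 ?sqr_ge0 ?dotp_ge0//.
by rewrite unit_dotp_le1// -sqrtr_sqr; congr (_, Num.sqrt _); ring.
Qed.

Lemma from_to_sphere z : X z -> from_sphere (to_sphere z) = (z.1, `|z.2|).
Proof.
move=> Xz; rewrite /from_sphere/= X0_dotp// -sqrtr_sqr; congr (_, Num.sqrt _); ring.
Qed.

Lemma X0_mirror (x : 'rV[R]_d) (t : R) : X (x, t) -> X (x, - t).
Proof. by rewrite /X0/heights/= sqrrN normrN. Qed.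

Lemma even_from_to_sphere (f : point -> R) z :
  (forall x t, X (x, t) -> f (x, t) = f (x, - t)) -> X z -> f (from_sphere (to_sphere z)) = f z.
Proof.
move=> fe Xz; rewrite from_to_sphere//; case: z Xz => x t /= Xz.
by case: (ger0P t) => t0 //; rewrite [RHS]fe.
Qed.

Definition great_circle u v (phi : R) : point := cos phi *: u + sin phi *: v.

Lemma great_circle_unit u v phi : ip u u = 1 -> ip v v = 1 -> ip u v = 0 ->
  ip (great_circle u v phi) (great_circle u v phi) = 1.
Proof.
move=> u1 v1 uv; rewrite ipDl !ipDr u1 v1 uv (ipC v) uv -[RHS](cos2Dsin2 phi); ring.
Qed.

(** An inequality because the circle is folded at the equator: reflecting a point to the upper side
    can only increase its inner product with [to_sphere z]. *)
Lemma dist_great_circle z v phi : X z -> ip v v = 1 -> ip (to_sphere z) v = 0 ->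
  `|phi| <= pi -> dist z (from_sphere (great_circle (to_sphere z) v phi)) <= `|phi|.
Proof.
move=> Xz v1 zv phi_pi; have z1 := to_sphere_unit Xz.
have g1 := great_circle_unit phi z1 v1 zv.
rewrite dist_le ?normr_ge0//; last exact: from_sphere_X0.
rewrite to_from_sphere// cos_norm; set g := great_circle _ _ _ in g1 *.
have -> : cos phi = ip (to_sphere z) g by rewrite ipDr z1 zv; ring.
rewrite /ip/= lerD2l ler_wpM2l ?sqrtr_ge0//; exact: ler_norm.
Qed.

(** Gram-Schmidt on the images on the sphere; the distance is at most 1 < pi, so its sine, by which
    one divides, is positive once the distance is. At distance zero z and y may still be mirror
    images, hence the first alternative. *)
Lemma great_circle_through z y : X z -> X y -> dist z y <= 1 ->
  from_sphere (to_sphere z) = from_sphere (to_sphere y) \/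
  exists v, [/\ ip v v = 1, ip (to_sphere z) v = 0 &
    great_circle (to_sphere z) v (dist z y) = to_sphere y].
Proof.
move=> Xz Xy zy1; have z1 := to_sphere_unit Xz; have y1 := to_sphere_unit Xy.
have /andP[d0 dpi] := dist_bounds Xz Xy.
have cE : cos (dist z y) = ip (to_sphere z) (to_sphere y).
  by rewrite distE acosK// in_itv/= ip_unit_bounds.
move: d0; rewrite le_eqVlt => /predU1P[d0|d0].
  left; congr from_sphere; apply/eqP; rewrite -subr_eq0; apply/eqP/ip_eq0.
  have -> : to_sphere z - to_sphere y = 1 *: to_sphere z + (-1) *: to_sphere y.
    by rewrite scale1r scaleN1r.
  rewrite ipDl !ipDr z1 y1 (ipC (to_sphere y)) -cE -d0 cos0; ring.
right; have s0 : 0 < sin (dist z y).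
  apply: sin_gt0_pi; rewrite d0/=; apply: le_lt_trans zy1 _.
  by have := @pi_ge2 R; lra.
set s := sin _ in s0; set c := cos _ in cE.
have cs : c ^+ 2 + s ^+ 2 = 1 by rewrite cos2Dsin2.
have s1 : s != 0 by rewrite gt_eqF.
exists ((- c / s) *: to_sphere z + s^-1 *: to_sphere y); split.
- rewrite ipDl !ipDr z1 y1 (ipC (to_sphere y)) -cE.
  have -> : - c / s * (- c / s * 1 + s^-1 * c) + s^-1 * (- c / s * c + s^-1 * 1) =
    (1 - c ^+ 2) / s ^+ 2 by field.
  by rewrite -cs addrC addKr divff// expf_neq0.
- by rewrite ipDr z1 -cE; field.
- rewrite /great_circle -/c -/s scalerDr !scalerA addrA -scalerDl.
  by rewrite mulrCA divff// mulr1 subrr scale0r add0r scale1r.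
Qed.

End double_hyperboloid.


(** * Even polynomials: restriction to great circles, and peaked kernels *)

Section even_polynomials.
Context {R : realType} {d : nat} (rho : R).
Hypothesis rho_ge0 : 0 <= rho.
Local Notation point := ('rV[R]_d * R)%type.
Local Notation X := (@X0 R d rho).
Local Notation dist := (@dist_X0 R d rho).
Local Notation PiE := (@PiE R d rho).
Implicit Types (z y v u : point) (f g : point -> R) (p q : mpoly (d + 1) R).

Lemma coordinates_lshift z i : coordinates z (lshift 1 i) = z.1 ord0 i.
Proof. by rewrite /coordinates row_mxEl. Qed.

Lemma coordinates_rshift z i : coordinates z (rshift d i) = z.2.
Proof. by rewrite /coordinates row_mxEr mxE. Qed.

Lemma msize_leP n p :
  (forall m, mcoeff m p != 0 -> (mdeg m <= n)%N) <-> (mmeasure mdeg p <= n.+1)%N.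
Proof.
split=> [H|H m m0].
  rewrite msizeE big_seq; apply: (big_ind (fun k => (k <= n.+1)%N)) => //.
    by move=> a b an bn; rewrite geq_max an.
  by move=> m; rewrite mcoeff_msupp ltnS; exact: H.
by rewrite -ltnS; apply: leq_trans H; rewrite msize_mdeg_lt// mcoeff_msupp.
Qed.

Lemma PiE_ext n f g : PiE n f -> (forall z, X z -> g z = f z) -> PiE n g.
Proof.
move=> [[p pn fp] fe] fg; split.
  by exists p => // z Xz; rewrite fg// fp.
by move=> x t Xz; rewrite !fg ?(fe _ _ Xz)//; exact: X0_mirror.
Qed.

Lemma PiE_leq m n f : (m <= n)%N -> PiE m f -> PiE n f.
Proof.
move=> mn [[p pn fp] fe]; split => //; exists p => // k /pn km.
exact: leq_trans mn.
Qed.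

Lemma PiE_cst n (c : R) : PiE n (fun=> c).
Proof.
split=> //; exists (mpolyC _ c).
  by apply/msize_leP; rewrite msizeC; case: (_ != _).
by move=> z _; rewrite mevalC.
Qed.

Lemma PiE_lin n (a : R) f g : PiE n f -> PiE n g -> PiE n (fun z => a * f z + g z).
Proof.
move=> [[p /msize_leP pn fp] fe] [[q /msize_leP qn gq] ge]; split.
  exists (a *: p + q).
    apply/msize_leP; rewrite (leq_trans (msizeD_le _ _))// geq_max qn andbT.
    exact: leq_trans (msizeZ_le _ _) pn.
  by move=> z Xz; rewrite mevalD mevalZ fp// gq.
by move=> x t Xz; rewrite fe// ge.
Qed.

Lemma PiE_mul m n f g : PiE m f -> PiE n g -> PiE (m + n) (fun z => f z * g z).
Proof.
move=> [[p /msize_leP pn fp] fe] [[q /msize_leP qn gq] ge]; split.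
  exists (p * q); last by move=> z Xz; rewrite mevalM fp// gq.
  apply/msize_leP; have [->|p0] := eqVneq p 0; first by rewrite mul0r msize0.
  have [->|q0] := eqVneq q 0; first by rewrite mulr0 msize0.
  by rewrite msizeM// -subn1 leq_subLR add1n -addSn -addnS leq_add.
by move=> x t Xz; rewrite fe// ge.
Qed.

Lemma PiE_coord i : PiE 1 (fun z => z.1 ord0 i).
Proof.
split=> //; exists (mpolyX R (mnm1 (lshift 1 i))).
  by apply/msize_leP; rewrite msizeX mdeg1.
by move=> z _; rewrite mevalXU coordinates_lshift.
Qed.

Lemma PiE_sqr_height : PiE 2 (fun z => z.2 ^+ 2).
Proof.
split; last by move=> x t _; rewrite /= sqrrN.
exists (mpolyX R (mnm1 (rshift d ord0)) * mpolyX R (mnm1 (rshift d ord0))).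
  by apply/msize_leP; rewrite msizeM ?msizeX ?mdeg1// -msize_poly_eq0 msizeX.
by move=> z _; rewrite mevalM mevalXU coordinates_rshift expr2.
Qed.

Lemma PiE_sum n (I : Type) (s : seq I) (F : I -> point -> R) :
  (forall i, PiE n (F i)) -> PiE n (fun z => \sum_(i <- s) F i z).
Proof.
move=> HF; elim: s => [|i s IH].
  by apply: PiE_ext (PiE_cst n 0) _ => z _; rewrite big_nil.
apply: PiE_ext (PiE_lin 1 (HF i) IH) _ => z _.
by rewrite big_cons mul1r.
Qed.

Lemma meval_coordinates p z : meval (coordinates z) p =
  \sum_(m <- msupp p) mcoeff m p *
    (\prod_(i < d) z.1 ord0 i ^+ m (lshift 1 i) * z.2 ^+ m (rshift d ord0)).
Proof.
rewrite mevalE; apply: eq_bigr => m _; congr *%R.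
rewrite big_split_ord/= big_ord1 coordinates_rshift; congr *%R.
by apply: eq_bigr => i _; rewrite coordinates_lshift.
Qed.

Lemma X0_coord_le1 z i : X z -> `|z.1 ord0 i| <= 1.
Proof.
move=> Xz; rewrite -(expr_le1 (n := 2))// real_normK ?num_real//.
apply: (@le_trans _ _ (dotp z.1 z.1)).
  rewrite /dotp (bigD1 i)//= -expr2 lerDl sumr_ge0// => j _.
  by rewrite -expr2 sqr_ge0.
by rewrite (X0_dotp Xz); have := X0_height Xz; lra.
Qed.

Lemma PiE_bounded n f : PiE n f -> exists B, forall z, X z -> `|f z| <= B.
Proof.
move=> [[p _ fp] _]; pose H := Num.sqrt (rho ^+ 2 + 1).
exists (\sum_(m <- msupp p) `|mcoeff m p| * H ^+ m (rshift d ord0)) => z Xz.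
rewrite fp// meval_coordinates; apply: le_trans (ler_norm_sum _ _ _) _.
apply: ler_sum => m _; rewrite normrM ler_wpM2l// normrM.
rewrite -[leRHS]mul1r; apply: ler_pM => //.
  rewrite normr_prod; apply: prodr_ile1 => i _.
  by rewrite normr_ge0 normrX exprn_ile1// X0_coord_le1.
rewrite normrX lerXn2r// ?nnegrE ?sqrtr_ge0//.
by case: Xz => _ /andP[].
Qed.

Lemma measurable_PiE n f : PiE n f -> measurable_fun X f.
Proof.
move=> [[p _ fp] _].
apply: (eq_measurable_fun (fun z => meval (coordinates z) p)).
  by move=> z; rewrite inE => Xz; rewrite fp.
apply: measurable_funTS.
under eq_fun do rewrite meval_coordinates.
apply: measurable_sum => m; apply: measurable_funM; first exact: measurable_cst.
apply: measurable_funM.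
  apply: measurable_prod => i _; apply: measurable_funX.
  by apply: (measurableT_comp (measurable_coor i)); exact: measurable_fst.
by apply: measurable_funX; exact: measurable_snd.
Qed.

Lemma trig_coord u v i : trig 1 (fun phi => (great_circle u v phi).1 ord0 i).
Proof.
apply: (@trig_ext R _ ((fun phi => u.1 ord0 i * cos (1%:R * phi + 0)) \+
                   (fun phi => v.1 ord0 i * cos (1%:R * phi + - (pi / 2))))).
  by apply: trig_add; exact: trig_wave.
by move=> phi /=; rewrite !mxE !mul1r addr0 cosBpihalf; ring.
Qed.

Lemma trig_prod (I : Type) (s : seq I) (e : I -> nat) (F : I -> R -> R) :
  (forall i, trig (e i) (F i)) ->
  trig (\sum_(i <- s) e i) (fun phi => \prod_(i <- s) F i phi).
Proof.
move=> HF; elim: s => [|i s IH].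
  by apply: trig_ext (trig_cst _ 1) _ => x; rewrite big_nil.
by rewrite big_cons; apply: trig_ext (trigM (HF i) IH) _ => x; rewrite big_cons.
Qed.

(** The height sqrt (rho^2 + |x|^2) along a great circle need not be a trigonometric polynomial.
    Averaging the polynomial over t and -t, which leaves f unchanged, removes the odd powers of t,
    and t^k with k even is the power k / 2 of a trigonometric polynomial of degree 2; [q] is the
    averaged power. *)
Lemma PiE_trig n f u v : PiE n f -> ip u u = 1 -> ip v v = 1 -> ip u v = 0 ->
  trig n (fun phi => f (from_sphere rho (great_circle u v phi))).
Proof.
move=> [[p pn fp] fe] u1 v1 uv.
pose g phi := (great_circle u v phi).1.
pose q (k : nat) phi : R := if odd k then 0 else (rho ^+ 2 + dotp (g phi) (g phi)) ^+ k./2.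
have tdot : trig 2 (fun phi => rho ^+ 2 + dotp (g phi) (g phi)).
  apply: (trig_add (trig_cst _ _)); apply: trig_sum => i _.
  exact: (trigM (trig_coord u v i) (trig_coord u v i)).
have tq k : trig k (q k).
  rewrite /q; case ok : (odd k); first exact: trig_cst.
  have e : (2 * k./2)%N = k by rewrite mul2n -[RHS]odd_double_half ok.
  by rewrite -[X in trig X]e; exact: trigX.
pose F m phi := mcoeff m p *
    (\prod_(i < d) (g phi) ord0 i ^+ m (lshift 1 i) * q (m (rshift d ord0)) phi).
have tF m : mcoeff m p != 0 -> trig n (F m).
  move=> /pn mn; apply: trig_leq mn _.
  rewrite mdegE big_split_ord/= big_ord1 -[X in trig X](add0n _).
  apply: (trigM (trig_cst 0 _)); apply: trigM; last exact: tq.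
  apply: trig_prod => i; rewrite -[X in trig X]mul1n.
  exact: trigX (trig_coord u v i).
apply: (@trig_ext R _ (fun phi => \sum_(m <- msupp p) F m phi)).
  apply: (@trig_ext R _ (fun phi => \sum_(m <- msupp p | mcoeff m p != 0) F m phi)).
    exact: trig_sum.
  move=> phi; rewrite big_mkcond/=; apply: eq_bigr => m _.
  by case: eqP => //; rewrite /F => ->; rewrite mul0r.
move=> phi; have g1 := great_circle_unit phi u1 v1 uv.
have Xd := from_sphere_X0 rho_ge0 g1.
set z := from_sphere rho _ in Xd *.
have zE : z = (z.1, z.2) by case: (z).
have Xd' : X (z.1, - z.2) by apply: X0_mirror; rewrite -zE.
have -> : f z = 2^-1 * (f z + f (z.1, - z.2)).
  by rewrite {3}zE -fe -?zE//; lra.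
rewrite !fp// !meval_coordinates -big_split/= mulr_sumr.
apply: eq_bigr => m _; rewrite -mulrDr mulrCA; congr *%R.
rewrite -mulrDr mulrCA; congr *%R; set k := m _.
rewrite /q -/(g phi); set D := _ + dotp _ _.
have D0 : 0 <= D by rewrite addr_ge0 ?sqr_ge0 ?dotp_ge0.
have -> : (- z.2) ^+ k = (-1) ^+ k * z.2 ^+ k by exact: exprNn.
rewrite -signr_odd; case: ifPn => ok; rewrite ?expr1 ?expr0.
  by rewrite mulN1r subrr mulr0.
rewrite mul1r -[k in RHS]odd_double_half (negbTE ok) add0n -mul2n exprM.
by rewrite /z/= sqr_sqrtr//; field.
Qed.

(** On the great circle from y through v, the maximal function at y supplies the growth bound of
    [trig_local_lipschitz], since the distance to y is at most |phi|. *)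
Lemma PiE_lipschitz l : exists2 C : R, 0 < C & forall n f, (0 < n)%N -> PiE n f ->
  forall y v, X y -> X v -> n%:R * dist y v <= 1 ->
  `|f v - f y| <= C * (n%:R * dist y v) * peetre_max X (fun z z' => n%:R * dist z z') l f y.
Proof.
have [C C0 HC] := @trig_local_lipschitz R l; exists C => // n f n0 Pf y v Xy Xv yv.
have [B fB] := PiE_bounded Pf.
have fe : forall x t, X (x, t) -> f (x, t) = f (x, - t) by case: Pf.
have D0 a b : X a -> X b -> 0 <= n%:R * dist a b.
  by move=> Xa Xb; rewrite mulr_ge0//; case/andP: (dist_bounds Xa Xb).
have n1 : 1 <= n%:R :> R by rewrite ler1n.
have /andP[d0 dpi] := dist_bounds Xy Xv.
have d1 : dist y v <= 1 by apply: le_trans yv; rewrite ler_peMl.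
rewrite -(even_from_to_sphere fe Xv) -(even_from_to_sphere fe Xy).
have M0 := peetre_max_ge0 D0 l fB Xy; have Mub := peetre_max_ub D0 l fB Xy.
set M := peetre_max _ _ _ _ _ in M0 Mub *.
have [->|[w [w1 yw gw]]] := great_circle_through Xy Xv d1.
  by rewrite subrr normr0 !mulr_ge0// ltW.
have tT := PiE_trig Pf (to_sphere_unit Xy) w1 yw.
have := HC n _ M n0 tT _ (dist y v); rewrite gw.
have -> : great_circle (to_sphere rho y) w 0 = to_sphere rho y.
  by rewrite /great_circle cos0 sin0 scale1r scale0r addr0.
rewrite (ger0_norm d0); apply => // phi phi_pi.
have g1 := great_circle_unit phi (to_sphere_unit Xy) w1 yw.
have Xg := from_sphere_X0 rho_ge0 g1.
apply: le_trans (Mub _ Xg) _; rewrite ler_wpM2l//.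
have h1 := D0 _ _ Xy Xg.
have h2 : n%:R * dist y (from_sphere rho (great_circle (to_sphere rho y) w phi)) <= n%:R * `|phi|.
  by rewrite ler_wpM2l//; exact: dist_great_circle.
by apply: lerXn2r; rewrite ?lerD2l// nnegrE addr_ge0// mulr_ge0.
Qed.

Lemma PiE_dotp (x : 'rV[R]_d) : PiE 1 (fun z => dotp x z.1).
Proof.
apply: PiE_sum => i.
apply: PiE_ext (PiE_lin (x ord0 i) (PiE_coord i) (PiE_cst 1 0)) _ => z _.
by rewrite addr0.
Qed.

(* (a+b)^j + (a-b)^j is even in b, so only b^2 enters. *)
Lemma PiE_sum_powers (a b : point -> R) j : PiE 1 a -> PiE 2 (fun z => b z ^+ 2) ->
  PiE j (fun z => (a z + b z) ^+ j + (a z - b z) ^+ j).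
Proof.
move=> Pa Pb.
suff [] : PiE j (fun z => (a z + b z) ^+ j + (a z - b z) ^+ j) /\
          PiE j.+1 (fun z => (a z + b z) ^+ j.+1 + (a z - b z) ^+ j.+1) by [].
elim: j => [|j [IH0 IH1]].
  split; first exact: PiE_ext (PiE_cst 0 2) _.
  apply: PiE_ext (PiE_lin 2 Pa (PiE_cst 1 0)) _ => z _.
  by rewrite !expr1; ring.
split => //.
(* a + b and a - b are the roots of X^2 - 2 a X + (a^2 - b^2), so the sums satisfy S_(j+2) = 2 a
   S_(j+1) + (b^2 - a^2) S_j. *)
have P2 : PiE 2 (fun z => b z ^+ 2 + - 1 * (a z * a z)).
  apply: PiE_ext (PiE_lin (-1) (PiE_mul Pa Pa) Pb) _ => z _; ring.
have h1 := PiE_mul Pa IH1; have h2 := PiE_mul P2 IH0.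
apply: PiE_ext (PiE_lin 2 h1 h2) _ => z _ /=.
by rewrite !exprS; ring.
Qed.

Lemma PiE_horner_sum n (P : {poly R}) (a b : point -> R) : (size P <= n.+1)%N ->
  PiE 1 a -> PiE 2 (fun z => b z ^+ 2) ->
  PiE n (fun z => P.[a z + b z] + P.[a z - b z]).
Proof.
move=> sP Pa Pb.
pose F (j : 'I_(size P)) z := P`_j * ((a z + b z) ^+ j + (a z - b z) ^+ j).
apply: (@PiE_ext _ (fun z => \sum_(j < size P) F j z)); last first.
  move=> z _; rewrite !horner_coef -big_split/=.
  by apply: eq_bigr => j _; rewrite -mulrDr.
apply: PiE_sum => j.
have jn : (j <= n)%N by rewrite -ltnS; apply: leq_trans (ltn_ord j) sP.
apply: PiE_ext (PiE_lin P`_j (PiE_leq jn (PiE_sum_powers j Pa Pb)) (PiE_cst n 0)) _.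
by move=> z _; rewrite addr0.
Qed.

(* K v = kappa (a + b) + kappa (a - b), where a + b and a - b are the cosines of
   the distances from [to_sphere z] to [to_sphere v] and to its reflection in
   the equator, and kappa (cos x) is an even power of a Dirichlet kernel. *)
Lemma PiE_kernel (p : nat) : exists2 C : R, 0 < C &
  forall n z, X z -> exists2 K, PiE n K &
  [/\ forall v, X v -> 0 <= K v, 1 <= K z &
      forall v, X v -> K v <= C / (1 + n%:R * dist z v) ^+ p].
Proof.
(* r absorbs the rounding in m below: for t <= pi <= 4, n t <= 2 (p + 1) (m + 1) t gives 1 + n t <=
   r (1 + m t). *)
pose r : R := 1 + 8 * p.+1%:R.
have r0 : 1 <= r by rewrite lerDl mulr_ge0.
exists (2 * (31 * r) ^+ (2 * p.+1)).
  by rewrite mulr_gt0// exprn_gt0// mulr_gt0//; lra.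
(* The power 2 (p + 1) of a kernel of degree m has degree at most n, and the even exponent makes it
   nonnegative. For small n, m is 0 and the kernel is constant. *)
move=> n z Xz; pose m := (n %/ (2 * p.+1))%N.
have [P sP PE] := @dirichlet_poly R m.
pose a v := dotp z.1 v.1.
pose b v := Num.sqrt (1 + rho ^+ 2 - z.2 ^+ 2) * Num.sqrt (1 + rho ^+ 2 - v.2 ^+ 2).
pose Q := P ^+ (2 * p.+1).
have z1 := to_sphere_unit Xz.
have bounds v : X v -> [/\ -1 <= a v + b v <= 1, -1 <= a v - b v <= 1 & 0 <= b v].
  move=> Xv; have v1 := to_sphere_unit Xv; split.
  - exact: (ip_unit_bounds z1 v1).
  - have w1 : ip ((to_sphere rho v).1, - (to_sphere rho v).2) ((to_sphere rho v).1, - (to_sphere rho v).2) = 1.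
      by rewrite /ip/= mulrNN; exact: v1.
    by have := ip_unit_bounds z1 w1; rewrite {1 2}/ip/= mulrN.
  - by rewrite mulr_ge0 ?sqrtr_ge0.
have QE c : -1 <= c <= 1 -> Q.[c] = dirichlet m (acos c) ^+ (2 * p.+1).
  by move=> c1; rewrite horner_exp -PE acosK// in_itv.
have even0 (x : R) : 0 <= x ^+ (2 * p.+1) by rewrite exprM exprn_ge0// sqr_ge0.
exists (fun v => Q.[a v + b v] + Q.[a v - b v]).
  apply: PiE_horner_sum.
  - rewrite (leq_trans (size_poly_exp_leq _ _))// ltnS.
    apply: (@leq_trans (m * (2 * p.+1))%N); last exact: leq_trunc_div.
    by rewrite leq_mul2r; apply/orP; right; case: (size P) sP.
  - exact: PiE_dotp.
  - pose s2 := 1 + rho ^+ 2 - z.2 ^+ 2.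
    apply: PiE_ext (PiE_lin (- s2) PiE_sqr_height (PiE_cst 2 (s2 * (1 + rho ^+ 2)))) _.
    move=> v Xv; rewrite /b exprMn !sqr_sqrtr; first by rewrite /s2; ring.
    + by have := X0_height Xv; lra.
    + by have := X0_height Xz; lra.
split.
- by move=> v Xv; have [h1 h2 _] := bounds v Xv; rewrite !QE// addr_ge0.
- have [h1 h2 _] := bounds z Xz; rewrite !QE//.
  have -> : a z + b z = 1 by exact: z1.
  by rewrite acos1 dirichlet0 expr1n lerDl.
move=> v Xv; have [h1 h2 b0] := bounds v Xv; rewrite !QE//.
have dE : dist z v = acos (a v + b v) by [].
have /andP[d0 dpi] := dist_bounds Xz Xv.
(* The reflected point is no closer, as b >= 0, so both terms decay in [dist z v]. *)
have dle : dist z v <= acos (a v - b v).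
  by rewrite dE acos_le ?acosK ?in_itv ?acos_ge0 ?acos_lepi//=; lra.
have n0 := ler0n R n.
have q1 : 1 <= 1 + n%:R * dist z v by rewrite lerDl mulr_ge0.
have q0 : 0 < 1 + n%:R * dist z v by lra.
have mr : n%:R <= 2 * p.+1%:R * (m%:R + 1) :> R.
  rewrite natr1 -!natrM ler_nat.
  by rewrite mulnC ltnW// ltn_ceil.
have pi4 : pi <= 4 :> R by have := @pihalf_lt2 R; lra.
have decay t : dist z v <= t -> t <= pi ->
    dirichlet m t ^+ (2 * p.+1) <= (31 * r) ^+ (2 * p.+1) / (1 + n%:R * dist z v) ^+ p.
  move=> dt tpi; have t0 : 0 <= t by lra.
  have := dirichlet_decay m (u := t); rewrite (ger0_norm t0) => H.
  have {}H : `|dirichlet m t| * (1 + m%:R * t) <= 31 by apply: H; lra.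
  have D : `|dirichlet m t| <= 31 * r / (1 + n%:R * dist z v).
    rewrite ler_pdivlMr//.
    have : 1 + n%:R * dist z v <= (1 + m%:R * t) * r.
      rewrite /r; have p0 := ler0n R p.+1; have m0 := ler0n R m.
      have : n%:R * dist z v <= 2 * p.+1%:R * (m%:R + 1) * t by exact: ler_pM.
      have : 0 <= p.+1%:R * t by rewrite mulr_ge0.
      have : 0 <= m%:R * t by rewrite mulr_ge0.
      have : 0 <= p.+1%:R * (m%:R * t) by rewrite !mulr_ge0.
      have : p.+1%:R * t <= p.+1%:R * 4 by rewrite ler_wpM2l//; lra.
      lra.
    move=> /(ler_wpM2l (normr_ge0 (dirichlet m t))) h; apply: le_trans h _.
    by rewrite mulrA ler_wpM2r//; lra.
  have -> : dirichlet m t ^+ (2 * p.+1) = `|dirichlet m t| ^+ (2 * p.+1).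
    by rewrite !exprM real_normK ?num_real.
  apply: (@le_trans _ _ ((31 * r / (1 + n%:R * dist z v)) ^+ (2 * p.+1))).
    by apply: lerXn2r; rewrite ?nnegrE ?divr_ge0 ?mulr_ge0//; lra.
  rewrite expr_div_n ler_wpM2l//.
  rewrite lef_pV2 ?posrE ?exprn_gt0// ler_weXn2l//.
  by rewrite mul2n -addnn addSn leqW// leq_addr.
have := decay _ (lexx _) dpi; have := decay _ dle; rewrite acos_lepi// => /(_ isT).
by rewrite -dE; lra.
Qed.

End even_polynomials.

(** * Partitions of unity subordinate to balls *)


Section weighted_integral.
Context {R : realType} {disp : measure_display} {T : measurableType disp}.
Variables (mu : {measure set T -> \bar R}) (X : set T) (w : T -> R).
Hypothesis mX : measurable X.
Hypothesis w_ge0 : forall z, X z -> 0 <= w z.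
Hypothesis w_int : mu.-integrable X (EFin \o w).
Implicit Types (f g : T -> R).

Definition bounded_measurable g : Prop :=
  measurable_fun X g /\ exists B, forall z, X z -> `|g z| <= B.

Definition wint g : R := \int[mu]_(z in X) (g z * w z).

Lemma bounded_measurable_lin (a : R) f g : bounded_measurable f -> bounded_measurable g ->
  bounded_measurable (fun z => a * f z + g z).
Proof.
move=> [mf [B fB]] [mg [C gC]]; split.
  by apply: measurable_funD => //; exact: measurable_funM.
exists (`|a| * B + C) => z Xz; apply: le_trans (ler_normD _ _) _.
by rewrite lerD ?gC// normrM ler_wpM2l ?fB.
Qed.

Lemma bounded_measurableM f g : bounded_measurable f -> bounded_measurable g ->
  bounded_measurable (fun z => f z * g z).
Proof.
move=> [mf [B fB]] [mg [C gC]]; split; first exact: measurable_funM.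
by exists (B * C) => z Xz; rewrite normrM ler_pM ?fB ?gC.
Qed.

Lemma bounded_measurable_cst (a : R) : bounded_measurable (fun=> a).
Proof. by split; [exact: measurable_cst|exists `|a|]. Qed.

Lemma bounded_measurable_indic (A : set T) : measurable A -> bounded_measurable \1_A.
Proof.
move=> mA; split; first exact: measurable_indic.
by exists 1 => z _; rewrite indicE; case: (_ \in _); rewrite ?normr1 ?normr0.
Qed.

Lemma bounded_measurable_sum (I : Type) (s : seq I) (P : pred I) (F : I -> T -> R) :
  (forall i, P i -> bounded_measurable (F i)) ->
  bounded_measurable (fun z => \sum_(i <- s | P i) F i z).
Proof.
move=> HF; elim: s => [|i s IH].
  under eq_fun do rewrite big_nil.
  exact: bounded_measurable_cst.
under eq_fun do rewrite big_cons.
case: (boolP (P i)) => // Pi.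
have := bounded_measurable_lin 1 (HF i Pi) IH.
by under eq_fun do rewrite mul1r.
Qed.

Lemma wint_integrable g : bounded_measurable g ->
  mu.-integrable X (EFin \o (fun z => g z * w z)).
Proof.
move=> [mg [B gB]].
apply: (@le_integrable _ _ _ mu X mX _ (fun z => `|B|%:E * (EFin \o w) z)%E).
- apply/measurable_EFinP; apply: measurable_funM => //.
  by apply/measurable_EFinP; exact: measurable_int w_int.
- move=> z Xz /=; rewrite lee_fin !normrM ler_wpM2r// normr_id.
  by apply: le_trans (gB z Xz) _; exact: ler_norm.
- exact: integrableZl.
Qed.

Lemma wint_lin (a : R) f g : bounded_measurable f -> bounded_measurable g ->
  wint (fun z => a * f z + g z) = a * wint f + wint g.
Proof.
move=> bf bg; rewrite /wint.
under eq_Rintegral do rewrite mulrDl -mulrA.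
rewrite RintegralD//; last 2 first.
- have := wint_integrable (bounded_measurable_lin a bf (bounded_measurable_cst 0)).
  by apply: eq_integrable => // z _ /=; rewrite addr0 mulrA.
- exact: wint_integrable.
by rewrite RintegralZl//; exact: wint_integrable.
Qed.

Lemma wint_le f g : bounded_measurable f -> bounded_measurable g ->
  (forall z, X z -> f z <= g z) -> wint f <= wint g.
Proof.
move=> bf bg fg; apply: le_Rintegral => //; try exact: wint_integrable.
by move=> z Xz; rewrite ler_wpM2r ?w_ge0 ?fg.
Qed.

Lemma wint_eq f g : (forall z, X z -> f z = g z) -> wint f = wint g.
Proof. by move=> fg; apply: eq_Rintegral => z; rewrite inE => Xz; rewrite fg. Qed.

Lemma wint_ge0 f : (forall z, X z -> 0 <= f z) -> 0 <= wint f.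
Proof. by move=> f0; apply: Rintegral_ge0 => z Xz; rewrite mulr_ge0 ?f0 ?w_ge0. Qed.

Lemma wintZ (a : R) f : bounded_measurable f -> wint (fun z => a * f z) = a * wint f.
Proof.
move=> bf; have := wint_lin a bf (bounded_measurable_cst 0).
rewrite (_ : wint (fun=> 0) = 0); last first.
  by rewrite /wint; under eq_Rintegral do rewrite mul0r; rewrite Rintegral_cst// mul0r.
by rewrite addr0 => <-; apply: wint_eq => z _; rewrite addr0.
Qed.

Lemma wint_sum (I : Type) (s : seq I) (P : pred I) (c : I -> R) (F : I -> T -> R) :
  (forall i, P i -> bounded_measurable (F i)) ->
  wint (fun z => \sum_(i <- s | P i) c i * F i z) = \sum_(i <- s | P i) c i * wint (F i).
Proof.
move=> HF.
have HcF i : P i -> bounded_measurable (fun z => c i * F i z).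
  by move=> Pi; apply: bounded_measurableM; [exact: bounded_measurable_cst|exact: HF].
elim: s => [|i s IH].
  rewrite big_nil -[RHS](mul0r (wint (fun=> 0))) -wintZ; last exact: bounded_measurable_cst.
  by apply: wint_eq => z _; rewrite big_nil mul0r.
rewrite big_cons -IH; case: (boolP (P i)) => Pi; last first.
  by apply: wint_eq => z _; rewrite big_cons (negbTE Pi).
rewrite -wint_lin; [|exact: HF|exact: bounded_measurable_sum].
by apply: wint_eq => z _; rewrite big_cons Pi.
Qed.

Lemma wint_indic (A : set T) : measurable A -> A `<=` X ->
  (\int[mu]_(z in A) (w z)%:E)%E = (wint \1_A)%:E.
Proof.
move=> mA AX; rewrite /wint /Rintegral fineK; last first.
  by apply: integrable_fin_num => //; exact: wint_integrable (bounded_measurable_indic mA).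
rewrite -[in LHS](setIidr AX) integral_mkcondr; apply: eq_integral => z _.
by rewrite patchE indicE; case: (_ \in _); rewrite ?mul1r ?mul0r.
Qed.

Lemma wint1_gt0 : ~ {ae mu, forall z, X z -> w z = 0} -> 0 < wint (fun=> 1).
Proof.
move=> nae; rewrite lt_neqAle wint_ge0 ?andbT//.
apply/eqP => w0; apply: nae.
have [H _] := ae_eq_integral_abs mu mX (measurable_int _ w_int).
suff : ae_eq mu X (EFin \o w) (cst 0%E).
  by apply: filterS => z /= h Xz; have [] := h Xz.
apply: H; rewrite -[RHS]/((0:R)%:E) w0 /wint /Rintegral fineK; last first.
  by apply: integrable_fin_num => //; exact: wint_integrable (bounded_measurable_cst 1).
apply: eq_integral => z; rewrite inE => Xz /=.
by rewrite mul1r ger0_norm ?w_ge0.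
Qed.

End weighted_integral.

Section covering_by_balls.
Context {R : realType} {disp : measure_display} {T : measurableType disp}.
Variables (mu : {measure set T -> \bar R}) (X : set T) (w : T -> R).
Hypothesis mX : measurable X.
Hypothesis w_ge0 : forall z, X z -> 0 <= w z.
Hypothesis w_int : mu.-integrable X (EFin \o w).
Variable D : T -> T -> R.
Hypothesis D_sym : forall x y, D x y = D y x.
Hypothesis D_tri : forall x y z, X x -> X y -> X z -> D x z <= D x y + D y z.

Definition ball_in (z : T) (r : R) : set T := [set y | X y /\ D z y <= r].

Hypothesis measurable_ball_in : forall z r, X z -> measurable (ball_in z r).

Definition ball_mass z r : R := wint mu X w \1_(ball_in z r).

Variables (Xi : seq T) (eta : R) (c : R).
Hypothesis Xi_X : forall v, v \in Xi -> X v.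

Definition multiplicity (y : T) : R := \sum_(v <- Xi) \1_(ball_in v eta) y.

Hypothesis covering : forall y, X y -> 1 <= multiplicity y <= c.

(* The balls cover X at most c times, so these functions form a partition of
   unity subordinate to the balls. *)
Definition cell (z y : T) : R := \1_(ball_in z eta) y / multiplicity y.

Definition cell_mass (z : T) : R := wint mu X w (cell z).

Let indic01 (A : set T) y : 0 <= (\1_A y : R) <= 1.
Proof. by rewrite indicE; case: (_ \in _); rewrite lexx ler01. Qed.

Let mult_gt0 y : X y -> 0 < multiplicity y.
Proof. by move=> Xy; have /andP[+ _] := covering Xy; exact: lt_le_trans. Qed.

Lemma cell_ge0 z y : 0 <= cell z y.
Proof.
by rewrite divr_ge0// sumr_ge0.
Qed.

Lemma sum_cell y : X y -> \sum_(v <- Xi) cell v y = 1.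
Proof.
move=> Xy; rewrite -mulr_suml divff//; exact: lt0r_neq0 (mult_gt0 Xy).
Qed.

Lemma bounded_measurable_cell z : X z -> bounded_measurable X (cell z).
Proof.
move=> Xz; split; last first.
  exists 1 => y Xy; have /andP[N1 _] := covering Xy.
  rewrite ger0_norm ?cell_ge0// ler_pdivrMr ?mult_gt0// mul1r.
  by apply: le_trans N1; have [] := andP (indic01 (ball_in z eta) y).
apply: measurable_funM; first by apply: measurable_indic; exact: measurable_ball_in.
have N0 y : 0 <= multiplicity y.
  by rewrite sumr_ge0// => v _; have [] := andP (indic01 (ball_in v eta) y).
rewrite (_ : (fun _ => _) = (fun y => multiplicity y `^ (- 1))); last first.
  by apply/funext => y; rewrite powR_inv1.
apply: (measurableT_comp (f := fun x : R => x `^ (- 1))); first exact: measurable_powR.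
rewrite /multiplicity; under eq_fun do rewrite big_seq_cond.
apply: (@bounded_measurable_sum _ _ _ X _ Xi _ (fun v => \1_(ball_in v eta)) _).1 => v.
by move=> /andP[/Xi_X Xv _]; exact: bounded_measurable_indic (measurable_ball_in _ Xv).
Qed.

Let bm_sum (P : pred T) : bounded_measurable X (fun y => \sum_(v <- Xi | P v) cell v y).
Proof.
under eq_fun do rewrite big_seq_cond.
by apply: bounded_measurable_sum => v /andP[/Xi_X Xv _]; exact: bounded_measurable_cell.
Qed.

Let wint_cells (P : pred T) :
  \sum_(v <- Xi | P v) cell_mass v = wint mu X w (fun y => \sum_(v <- Xi | P v) cell v y).
Proof.
rewrite big_seq_cond.
under eq_bigr do rewrite -[cell_mass _]mul1r.
rewrite -wint_sum//; last by move=> v /andP[/Xi_X Xv _]; exact: bounded_measurable_cell.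
apply: wint_eq => y _; rewrite [RHS]big_seq_cond; apply: eq_bigr => v _; exact: mul1r.
Qed.

Lemma cell_mass_ge0 v : 0 <= cell_mass v.
Proof. by apply: wint_ge0 => // y _; exact: cell_ge0. Qed.

(** [cell v] lives on the eta-ball of v, which lies in the ball of radius r + eta at z. *)
Lemma sum_cell_mass_le z r : X z ->
  \sum_(v <- Xi | D z v <= r) cell_mass v <= ball_mass z (r + eta).
Proof.
move=> Xz; rewrite wint_cells; apply: wint_le => //.
  by apply: bounded_measurable_indic; exact: measurable_ball_in.
move=> y Xy; have [zy|zy] := leP (D z y) (r + eta).
  rewrite indicE mem_set// -[leRHS](sum_cell Xy) big_mkcond/=.
  by apply: ler_sum => v _; case: ifP => // _; exact: cell_ge0.
rewrite big_seq_cond big1 ?indicE//.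
move=> v /andP[/Xi_X Xv zv]; rewrite /cell indicE memNset ?mul0r// => -[_ vy].
by have := D_tri Xz Xv Xy; rewrite leNgt => /negP; apply; lra.
Qed.

(** On the r-ball of z the cells of the nodes within r + eta already sum to 1, since all others
    vanish there. *)
Lemma sum_cell_mass_ge z r : X z ->
  ball_mass z r <= \sum_(v <- Xi | D z v <= r + eta) cell_mass v.
Proof.
move=> Xz; rewrite wint_cells; apply: wint_le => //.
  by apply: bounded_measurable_indic; exact: measurable_ball_in.
move=> y Xy; have [zy|zy] := leP (D z y) r; last first.
  rewrite indicE memNset; last by case=> _; rewrite leNgt zy.
  by apply: sumr_ge0 => v _; exact: cell_ge0.
rewrite indicE mem_set// -(sum_cell Xy) [leRHS]big_mkcond/= big_seq [leRHS]big_seq.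
apply: ler_sum => v /Xi_X Xv; case: ifPn => // zv.
rewrite /cell indicE memNset ?mul0r// => -[_ vy]; move/negP: zv; apply.
by apply: le_trans (D_tri Xz Xy Xv) _; rewrite lerD// D_sym.
Qed.

Lemma cell_mass_bounds z : X z ->
  ball_mass z eta / c <= cell_mass z <= ball_mass z eta.
Proof.
move=> Xz; have c1 : 1 <= c.
  by have /andP[h1 h2] := covering Xz; exact: le_trans h2.
have bi := bounded_measurable_indic (R := R) X (measurable_ball_in eta Xz).
have bc := bounded_measurable_cell Xz.
apply/andP; split.
  rewrite mulrC -wintZ//; apply: wint_le => //.
    by apply: bounded_measurableM => //; exact: bounded_measurable_cst.
  move=> y Xy; rewrite mulrC /cell ler_wpM2l//.
  have /andP[N1 Nc] := covering Xy.
  by rewrite lef_pV2 ?posrE ?mult_gt0//; lra.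
apply: wint_le => // y Xy; rewrite ler_pdivrMr ?mult_gt0// ler_peMr//.
by have /andP[h1 _] := covering Xy.
Qed.

(** As the cells sum to 1, f minus the combination of the cells with coefficients f z is the sum of
    the (f - f z) [cell z], and each term is supported where the oscillation bound applies. *)
Lemma wint_oscillation f (h : T -> R) : bounded_measurable X f ->
  (forall z y, z \in Xi -> X y -> D z y <= eta -> `|f y - f z| <= h z) ->
  `|wint mu X w f - \sum_(z <- Xi) cell_mass z * f z| <= \sum_(z <- Xi) cell_mass z * h z.
Proof.
move=> bf osc.
have bm (g : T -> R) : bounded_measurable X (fun y => \sum_(z <- Xi) g z * cell z y).
  under eq_fun do rewrite big_seq.
  apply: bounded_measurable_sum => z /Xi_X Xz.
  by apply: bounded_measurableM; [exact: bounded_measurable_cst|exact: bounded_measurable_cell].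
have wE (g : T -> R) : wint mu X w (fun y => \sum_(z <- Xi) g z * cell z y) =
    \sum_(z <- Xi) cell_mass z * g z.
  rewrite big_seq (_ : (fun y => _) = (fun y => \sum_(z <- Xi | z \in Xi) g z * cell z y)).
    rewrite wint_sum//; first by apply: eq_bigr => z _; rewrite mulrC.
    by move=> z /Xi_X Xz; exact: bounded_measurable_cell.
  by apply/funext => y; rewrite big_seq.
have key (y : T) : X y -> `|f y - \sum_(z <- Xi) f z * cell z y| <= \sum_(z <- Xi) h z * cell z y.
  move=> Xy; rewrite -{1}[f y]mulr1 -(sum_cell Xy) mulr_sumr -sumrB.
  apply: le_trans (ler_norm_sum _ _ _) _; rewrite big_seq [leRHS]big_seq.
  apply: ler_sum => z zXi; rewrite -mulrBl normrM (ger0_norm (cell_ge0 _ _)).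
  have [zy|zy] := leP (D z y) eta; first by rewrite ler_wpM2r ?cell_ge0// osc.
  by rewrite /cell indicE memNset ?mul0r ?mulr0// => -[_]; rewrite leNgt zy.
rewrite ler_norml; apply/andP; split.
  rewrite lerBrDr addrC -sumrB.
  rewrite (eq_bigr (fun z => cell_mass z * (f z - h z))); last by move=> z _; rewrite mulrBr.
  rewrite -wE; apply: wint_le => // y Xy.
  have := key y Xy; rewrite ler_norml => /andP[+ _].
  under [X in _ -> X <= _]eq_bigr do rewrite mulrBl.
  by rewrite sumrB; lra.
rewrite lerBlDr -big_split/=.
rewrite (eq_bigr (fun z => cell_mass z * (h z + f z))); last by move=> z _; rewrite mulrDr.
rewrite -wE; apply: wint_le => // y Xy.
have := key y Xy; rewrite ler_norml => /andP[_].
under [X in _ -> _ <= X]eq_bigr do rewrite mulrDl.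
by rewrite big_split/=; lra.
Qed.

End covering_by_balls.


(** * Measurability of balls and invariance under t -> -t *)

Section reflection.
Context {R : realType} {d : nat} (rho : R).
Local Notation point := ('rV[R]_d * R)%type.
Local Notation X := (@X0 R d rho).
Local Notation dist := (@dist_X0 R d rho).
Implicit Types z y v : point.

Lemma measurable_X0 : measurable X.
Proof.
have mh : measurable ((@snd 'rV[R]_d R) @^-1` heights rho).
  rewrite -[X in measurable X]setTI; apply: measurable_snd => //.
  exact: measurable_heights.
pose g z := enorm z.1 ^+ 2 - (z.2 ^+ 2 - rho ^+ 2).
have mg : measurable_fun setT g.
  apply: measurable_funB.
    apply: measurable_funX; apply: (measurableT_comp (@measurable_enorm R d)).
    exact: measurable_fst.
  by apply: measurable_funB => //; apply: measurable_funX; exact: measurable_snd.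
rewrite (_ : X = (g @^-1` [set 0]) `&` ((@snd 'rV[R]_d R) @^-1` heights rho)).
  apply: measurableI => //; rewrite -[X in measurable X]setTI.
  by apply: mg => //; exact: measurable_set1.
apply/seteqP; split => z /=.
  by case=> e h; split => //; rewrite /g e subrr.
by case=> /eqP; rewrite subr_eq0 => /eqP.
Qed.

(** For 0 <= r < pi the ball is a superlevel set of the inner product; otherwise it is empty or
    everything. *)
Lemma measurable_dist_ball z r : X z -> measurable (ball_in X dist z r).
Proof.
move=> Xz; have mX := measurable_X0.
have [r0|r0] := ltP r 0.
  rewrite (_ : ball_in _ _ _ _ = set0)//; apply/seteqP; split => // y [Xy zy].
  by have /andP[] := dist_bounds Xz Xy; lra.
have [rpi|rpi] := leP pi r.
  rewrite (_ : ball_in _ _ _ _ = X)//; apply/seteqP; split => [y []//|y Xy].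
  by split => //; have /andP[_] := dist_bounds Xz Xy; lra.
rewrite (_ : ball_in _ _ _ _ = X `&` [set y | cos r <= ip (to_sphere rho z) (to_sphere rho y)]).
  apply: (@measurable_fun_le _ _ R X (fun=> cos r)
    (fun y => ip (to_sphere rho z) (to_sphere rho y))) => //.
  apply: measurable_funTS; rewrite /ip /dotp; apply: measurable_funD.
    apply: measurable_sum => i; apply: measurable_funM; first exact: measurable_cst.
    by apply: (measurableT_comp (measurable_coor i)); exact: measurable_fst.
  apply: measurable_funM; first exact: measurable_cst.
  apply: (measurableT_comp (f := @Num.sqrt R)).
    by apply: continuous_measurable_fun; exact: sqrt_continuous.
  by apply: measurable_funB => //; apply: measurable_funX; exact: measurable_snd.
have r1 : 0 <= r <= pi by rewrite r0 ltW.
apply/seteqP; split => y [Xy zy]; split => //=.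
  by rewrite -(dist_le Xz Xy r1).
by rewrite (dist_le Xz Xy r1).
Qed.

Lemma measurable_cball z r : X z -> measurable (cball rho z r).
Proof.
move=> Xz.
have m1 : measurable ((@snd 'rV[R]_d R) @^-1` [set t | 0 <= t]).
  rewrite -[X in measurable X]setTI; apply: measurable_snd => //.
  by rewrite -set_itvcy; exact: measurable_itv.
have m2 : measurable ((@snd 'rV[R]_d R) @^-1` [set t | t <= 0]).
  rewrite -[X in measurable X]setTI; apply: measurable_snd => //.
  by rewrite -set_itvNyc; exact: measurable_itv.
have mc (P : Prop) : measurable [set y : point | P].
  have [p|np] := pselect P.
    by rewrite (_ : [set _ | _] = setT)//; apply/seteqP; split.
  by rewrite (_ : [set _ | _] = set0)//; apply/seteqP; split.
rewrite (_ : cball rho z r = ball_in X dist z r `&`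
  (([set y : point | 0 <= z.2] `&` ((@snd 'rV[R]_d R) @^-1` [set t | 0 <= t])) `|`
   ([set y : point | z.2 <= 0] `&` ((@snd 'rV[R]_d R) @^-1` [set t | t <= 0])))).
  apply: measurableI; first exact: measurable_dist_ball.
  by apply: measurableU; apply: measurableI.
apply/seteqP; split => y; first by move=> [Xy p zy].
by move=> [[Xy zy] p].
Qed.

Definition mirror z : point := (z.1, - z.2).

Lemma mirrorK : involutive mirror.
Proof. by case=> x t; rewrite /mirror/= opprK. Qed.

Lemma measurable_mirror : measurable_fun setT mirror.
Proof.
apply: measurable_fun_pair; first exact: measurable_fst.
by apply: measurable_funN; exact: measurable_snd.
Qed.

Lemma X0_mirrorE z : X z -> X (mirror z).
Proof. by case: z => x t; exact: X0_mirror. Qed.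

Lemma dist_mirrorl z y : dist (mirror z) y = dist z y.
Proof. by rewrite /dist_X0/= sqrrN. Qed.

Lemma dist_mirrorr z y : dist z (mirror y) = dist z y.
Proof. by rewrite /dist_X0/= sqrrN. Qed.

Lemma same_part_mirror z y : same_part (mirror z) (mirror y) <-> same_part z y.
Proof. by rewrite /same_part/= !oppr_ge0 !oppr_le0; split=> -[]; [right|left|right|left]. Qed.

Lemma same_part_or z y : same_part z y \/ same_part z (mirror y).
Proof.
rewrite /same_part/= oppr_ge0 oppr_le0.
by case/orP: (le_total 0 z.2) => ?; case/orP: (le_total 0 y.2) => ?; tauto.
Qed.

Lemma preimage_mirror_cball z r :
  mirror @^-1` cball rho (mirror z) r = cball rho z r.
Proof.
apply/seteqP; split => y /= [Xy p zy].
  split; [|exact/same_part_mirror|by rewrite dist_mirrorl dist_mirrorr in zy].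
  by rewrite -(mirrorK y); exact: X0_mirrorE.
split; [exact: X0_mirrorE|exact/same_part_mirror|].
by rewrite dist_mirrorl dist_mirrorr.
Qed.

(** The slice of the preimage at height t is the slice of A at -t, on a sphere of the same radius,
    and Lebesgue measure on the line is invariant under negation. *)
Lemma sigma_mirror (A : set point) : measurable A ->
  sigma rho (mirror @^-1` A) = sigma rho A.
Proof.
move=> mA; pose F t := sphere_measure (Num.sqrt (t ^+ 2 - rho ^+ 2)) (ysection A t).
have mF : measurable_fun setT F.
  apply: (@measurable_fun_sphere_measure R d (fun t => Num.sqrt (t ^+ 2 - rho ^+ 2))) => //.
  apply: (measurableT_comp (f := @Num.sqrt R)).
    by apply: continuous_measurable_fun; exact: sqrt_continuous.
  by apply: measurable_funB => //; exact: measurable_funX.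
have F0 t : (0 <= F t)%E.
  by apply: mule_ge0; rewrite ?measure_ge0// lee_fin exprn_ge0// sqrtr_ge0.
have mh := @measurable_heights R rho.
transitivity (\int[@lebesgue_measure R]_(t in (-%R : _ -> measurableTypeR R) @^-1` heights rho)
    (F \o -%R) t)%E; last first.
  rewrite -ge0_integral_pushforward//; last exact: measurable_funTS.
  by apply: eq_measure_integral => B mB _; exact: lebesgue_measureN.
rewrite (_ : (-%R : _ -> measurableTypeR R) @^-1` heights rho = heights rho); last first.
  by apply/seteqP; split => t; rewrite /heights/= normrN.
apply: eq_integral => t _; rewrite /F/= sqrrN; congr (sphere_measure _ _).
Qed.

Lemma weight_measure_mirror (w : point -> R) z r : X z ->
  (forall y, X y -> 0 <= w y) ->
  (sigma rho).-integrable X (EFin \o w) ->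
  (forall x t, X (x, t) -> w (x, t) = w (x, - t)) ->
  weight_measure rho w (cball rho (mirror z) r) = weight_measure rho w (cball rho z r).
Proof.
move=> Xz w0 wi we; have Xr := X0_mirrorE Xz.
have mc := measurable_cball r Xr.
have sub : cball rho (mirror z) r `<=` X by move=> y [].
rewrite /weight_measure.
transitivity (\int[pushforward (sigma rho) mirror]_(y in cball rho (mirror z) r) (w y)%:E)%E.
  apply: eq_measure_integral; first exact: measurable_mirror.
  by move=> mr A mA _; exact/esym/sigma_mirror.
rewrite (ge0_integral_pushforward measurable_mirror)//; last 2 first.
- have := measurable_int _ wi; exact: measurable_funS measurable_X0 sub.
- by move=> y; rewrite inE => /sub Xy; rewrite lee_fin w0.
rewrite preimage_mirror_cball; apply: eq_integral => -[x t].
by rewrite inE => -[Xy _ _] /=; rewrite -we.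
Qed.

End reflection.

(** * The cubature formula *)


Section folded_balls.
Context {R : realType} {d : nat} (rho : R).
Local Notation point := ('rV[R]_d * R)%type.
Local Notation X := (@X0 R d rho).
Local Notation dist := (@dist_X0 R d rho).
Variable w : point -> R.
Hypothesis w_doubling : doubling_weight rho w.
Hypothesis w_even : forall x t, X (x, t) -> w (x, t) = w (x, - t).
Implicit Types z y v : point.

Let mX := @measurable_X0 R d rho.

Let w_ge0 : forall z, X z -> 0 <= w z.
Proof. by case: w_doubling. Qed.

Let w_int : (sigma rho).-integrable X (EFin \o w).
Proof. by case: w_doubling. Qed.

(* Balls for the pseudo-distance [dist_X0] on all of X0, which ignores the sign
   of the height: each is a ball [cball] together with its reflection. *)
Definition folded_mass z r : R := wint (sigma rho) X w \1_(ball_in X dist z r).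

Definition cball_mass z r : R := wint (sigma rho) X w \1_(cball rho z r).

Lemma weight_measure_cball z r : X z ->
  weight_measure rho w (cball rho z r) = (cball_mass z r)%:E.
Proof.
move=> Xz; apply: wint_indic => //; first exact: measurable_cball.
by move=> y [].
Qed.

Let bm_cball z r : X z -> bounded_measurable X (\1_(cball rho z r) : point -> R).
Proof. by move=> Xz; apply: bounded_measurable_indic; exact: measurable_cball. Qed.

Let bm_ball z r : X z -> bounded_measurable X (\1_(ball_in X dist z r) : point -> R).
Proof. by move=> Xz; apply: bounded_measurable_indic; exact: measurable_dist_ball. Qed.

Lemma cball_mass_mirror z r : X z -> cball_mass (mirror z) r = cball_mass z r.
Proof.
move=> Xz; apply: EFin_inj; rewrite -!weight_measure_cball//; last exact: X0_mirrorE.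
exact: weight_measure_mirror.
Qed.

Lemma indic_cball_le z r y : (\1_(cball rho z r) y : R) <= \1_(ball_in X dist z r) y.
Proof.
rewrite !indicE ler_nat; case: (boolP (y \in cball rho z r)) => //.
by rewrite inE => -[Xy _ zy]; rewrite mem_set.
Qed.

(** Either y or its mirror image lies in the same part as z, at the same distance from z. *)
Lemma indic_ball_le z r y : X z -> X y -> (\1_(ball_in X dist z r) y : R) <=
  \1_(cball rho z r) y + \1_(cball rho z r) (mirror y).
Proof.
move=> Xz Xy; rewrite !indicE -natrD ler_nat.
case: (boolP (y \in ball_in X dist z r)) => //; rewrite inE => -[_ zy].
case: (same_part_or z y) => p; first by rewrite mem_set// leq_addr.
rewrite [X in (_ <= _ + nat_of_bool X)%N]mem_set ?leq_addl//.
by split => //; [exact: X0_mirrorE|rewrite dist_mirrorr].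
Qed.

Lemma cball_mass_le_folded z r : X z -> cball_mass z r <= folded_mass z r.
Proof.
move=> Xz; apply: wint_le => //; [exact: bm_cball|exact: bm_ball|].
by move=> y _; exact: indic_cball_le.
Qed.

(** The reflected half of a folded ball is the ball at the mirror point, of equal mass since w is
    even. *)
Lemma folded_mass_le z r : X z -> folded_mass z r <= 2 * cball_mass z r.
Proof.
move=> Xz; have Xr := X0_mirrorE Xz.
have -> : 2 * cball_mass z r = 1 * cball_mass z r + cball_mass (mirror z) r.
  by rewrite cball_mass_mirror//; ring.
rewrite /cball_mass -wint_lin//; [|exact: bm_cball|exact: bm_cball].
apply: wint_le => //; first exact: bm_ball.
  by apply: bounded_measurable_lin; exact: bm_cball.
move=> y Xy; apply: le_trans (indic_ball_le _ Xz Xy) _.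
rewrite mul1r lerD2l !indicE ler_nat.
case: (boolP (mirror y \in cball rho z r)) => //; rewrite inE => H.
rewrite mem_set//; have : (@mirror R d @^-1` cball rho (mirror z) r) (mirror y).
  by rewrite preimage_mirror_cball.
by rewrite /= mirrorK.
Qed.

Lemma folded_mass_doubling : exists s : nat, forall z r, X z -> 0 < r ->
  folded_mass z (2 * r) <= 2 ^+ s * folded_mass z r.
Proof.
have [_ _ _ [L L0 HL]] := w_doubling.
exists (Num.truncn (2 * L)).+1 => z r Xz r0.
have L2 : 2 * L <= 2 ^+ (Num.truncn (2 * L)).+1.
  apply: (@le_trans _ _ (Num.truncn (2 * L)).+1%:R); first by rewrite ltW// truncnS_gt.
  by rewrite -natrX ler_nat ltnW// ltn_expl.
have c0 : 0 <= cball_mass z r.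
  by apply: wint_ge0 => // y _; rewrite indicE.
apply: le_trans (folded_mass_le _ Xz) _.
have := HL z r Xz r0; rewrite !weight_measure_cball// -EFinM lee_fin => H.
apply: (@le_trans _ _ (2 * L * cball_mass z r)).
  by rewrite -mulrA ler_wpM2l.
apply: ler_pM => //; first by rewrite mulr_ge0// ltW.
exact: cball_mass_le_folded.
Qed.

Lemma folded_mass_mono z y r r' : X z -> X y -> dist z y + r <= r' ->
  folded_mass z r <= folded_mass y r'.
Proof.
move=> Xz Xy H; apply: wint_le => //; [exact: bm_ball|exact: bm_ball|].
move=> v Xv; rewrite !indicE ler_nat; case: (boolP (v \in ball_in X dist z r)) => //.
rewrite inE => -[_ zv]; rewrite mem_set//; split => //.
by have := dist_triangle Xy Xz Xv; rewrite (dist_sym rho y z); lra.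
Qed.

(** Radius pi gives all of X0, of positive mass since w is not almost everywhere zero; doubling then
    passes down to r in finitely many halvings. *)
Lemma folded_mass_gt0 z r : X z -> 0 < r -> 0 < folded_mass z r.
Proof.
move=> Xz r0; have [_ _ nae _] := w_doubling; have [s Hs] := folded_mass_doubling.
have pos := wint1_gt0 mX w_ge0 w_int nae.
have big t : pi <= t -> 0 < folded_mass z t.
  move=> pit; rewrite (_ : folded_mass z t = wint (sigma rho) X w (fun=> 1))//.
  apply: wint_eq => y Xy; rewrite indicE mem_set//; split => //.
  by apply: le_trans pit; have /andP[] := dist_bounds Xz Xy.
have step k : 0 < folded_mass z (2 ^+ k * r) -> 0 < folded_mass z r.
  elim: k => [|k IH]; first by rewrite expr0 mul1r.
  rewrite exprS -mulrA => H; apply: IH.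
  have := Hs z (2 ^+ k * r) Xz; rewrite mulr_gt0 ?exprn_gt0// => /(_ isT) H2.
  have := lt_le_trans H H2; rewrite pmulr_rgt0// exprn_gt0//.
apply: (step (Num.truncn (pi / r)).+1); apply: big.
rewrite -ler_pdivrMr//; apply: (@le_trans _ _ (Num.truncn (pi / r)).+1%:R).
  by rewrite ltW// truncnS_gt.
by rewrite -natrX ler_nat ltnW// ltn_expl.
Qed.

End folded_balls.

Theorem theorem3p20 (R : realType) (d : nat) (hd : (2 <= d)%N)
    (cd : R) (hcd : 1 < cd) (rho : R) (hrho : 0 <= rho)
    (w : 'rV[R]_d * R -> R) (hw : doubling_weight rho w)
    (w_even : forall (x : 'rV[R]_d) (t : R),
       X0 rho (x, t) -> w (x, t) = w (x, - t)) :
  exists2 delta0 : R, 0 < delta0 &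
  forall delta : R, 0 < delta < delta0 ->
  exists c1 c2 : R, [/\ 0 < c1, 0 < c2 &
  forall (n : nat) (Xi : set ('rV[R]_d * R)), (1 <= n)%N ->
    maximal_separated rho cd (delta / n%:R) Xi -> evenly_symmetric Xi ->
  exists lambda : 'rV[R]_d * R -> R,
    [/\ forall z, Xi z -> 0 < lambda z,
        forall f, PiE rho n f ->
          (\int[sigma rho]_(z in X0 rho) (f z * w z)%:E)%E =
          (\sum_(z \in Xi) lambda z * f z)%:E &
        forall z, Xi z ->
          (c1%:E * weight_measure rho w (cball rho z (delta / n%:R)) <=
             (lambda z)%:E <=
           c2%:E * weight_measure rho w (cball rho z (delta / n%:R)))%E]].
Proof.
have mX := @measurable_X0 R d rho.
have [w0 wi _ _] := hw.
have [s Hs] := folded_mass_doubling hw w_even.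
have [C0 C00 lip] := @PiE_lipschitz R d rho hrho (3 * s + 1).
have [CK CK0 ker] := @PiE_kernel R d rho s.+1.
pose eps := (4 * C0 + 1)^-1.
have eps0 : 0 < eps by rewrite invr_gt0; lra.
have eps1 : eps <= 1 by rewrite invf_le1; lra.
have C0eps : C0 * eps <= 4^-1 by rewrite ler_pdivrMr; lra.
pose A := 2 ^+ (3 * s + 2) * (2 ^+ (2 * s + 3) * (4 / eps) ^+ s).
have pow_gt0 (x : R) k : 0 < x -> 0 < x ^+ k by exact: exprn_gt0.
have A0 : 0 < A by apply: mulr_gt0; [|apply: mulr_gt0]; apply: pow_gt0 => //; rewrite divr_gt0.
(* The hypotheses of [positive_quadrature] for eta = delta, distances being in units of 1 / n: the
   first bound gives eta <= eps / 2, the second C0 eta A <= 1/2. *)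
exists (Num.min (eps / 2) (2 * C0 * A)^-1).
  by rewrite lt_min divr_gt0//= invr_gt0 mulr_gt0// mulr_gt0.
move=> delta /andP[delta0]; rewrite lt_min => /andP[delta_eps delta_A].
(* The first constant is half of a cell mass with overlap 2 [cd]; the second is the bound of
   [positive_quadrature], doubled in passing from folded balls to balls in one part. *)
exists (4 * cd)^-1, (4 * CK * 2 ^+ (s.*2 + 2) * (2 / delta) ^+ s).
have c2_gt0 : 0 < 4 * CK * 2 ^+ (s.*2 + 2) * (2 / delta) ^+ s.
  by apply: mulr_gt0; [rewrite mulr_gt0 ?mulr_gt0 ?pow_gt0|rewrite pow_gt0 ?divr_gt0].
split => //; first by rewrite invr_gt0; lra.
move=> n Xi n1 [[fXi XiX _] mult] _.
have n0 : 0 < n%:R :> R by rewrite ltr0n.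
pose D (z y : 'rV[R]_d * R) := n%:R * dist_X0 rho z y.
pose S : seq ('rV[R]_d * R) := finmap.enum_fset (fset_set Xi).
have SE z : (z \in S) = (z \in Xi) by exact: in_fset_set.
have SX z : z \in S -> X0 rho z by rewrite SE inE; exact: XiX.
have D_ge0 x y : X0 rho x -> X0 rho y -> 0 <= D x y.
  by move=> Xx Xy; rewrite mulr_ge0//; have /andP[] := dist_bounds Xx Xy.
have D_sym x y : D x y = D y x by rewrite /D dist_sym.
have D_xx x : X0 rho x -> D x x = 0 by move=> Xx; rewrite /D dist_xx// mulr0.
have D_tri x y z : X0 rho x -> X0 rho y -> X0 rho z -> D x z <= D x y + D y z.
  by move=> Xx Xy Xz; rewrite -mulrDr ler_wpM2l// dist_triangle.
have ballE z r : ball_in (X0 rho) D z r = ball_in (X0 rho) (dist_X0 rho) z (r / n%:R).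
  have De y : (D z y <= r) = (dist_X0 rho z y <= r / n%:R) by rewrite ler_pdivlMr// mulrC.
  by apply/seteqP; split => y [Xy h]; split => //; rewrite ?De// -De.
have mB z r : X0 rho z -> measurable (ball_in (X0 rho) D z r).
  by move=> Xz; rewrite ballE; exact: measurable_dist_ball.
pose W z r := ball_mass (sigma rho) (X0 rho) w D z r.
have WE z r : W z r = folded_mass rho w z (r / n%:R) by rewrite /W /ball_mass ballE.
(* If y lies in the folded ball of v, then y or its mirror image lies in the ball of v within one
   part; each of the two points is covered at most [cd] times. *)
have cover y : X0 rho y -> 1 <= multiplicity (X0 rho) D S delta y <= 2 * cd.
  move=> Xy; have := mult _ Xy; have := mult _ (X0_mirrorE Xy).
  rewrite !fsbig_finite//= => /andP[_ h1] /andP[h2 h3].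
  rewrite /multiplicity; apply/andP; split.
    apply: le_trans h2 _; apply: ler_sum => v _; rewrite ballE.
    exact: indic_cball_le.
  apply: (@le_trans _ _ (\sum_(v <- S)
     (\1_(cball rho v (delta / n%:R)) y + \1_(cball rho v (delta / n%:R)) (mirror y)))).
    rewrite big_seq [leRHS]big_seq; apply: ler_sum => v /SX Xv; rewrite ballE.
    exact: indic_ball_le.
  by rewrite big_split/=; lra.
have [K DK] : exists K : nat, forall x y, X0 rho x -> X0 rho y -> 1 + D x y <= 2 ^+ K.
  exists (1 + n * 4)%N => x y Xx Xy.
  apply: (@le_trans _ _ (1 + n * 4)%:R); last first.
    by rewrite -natrX ler_nat ltnW// ltn_expl.
  rewrite natrD natrM lerD2l ler_wpM2l//.
  by have /andP[_] := dist_bounds Xx Xy; have := @pihalf_lt2 R; lra.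
pose m := cell_mass (sigma rho) (X0 rho) w D S delta.
have W_gt0 z r : X0 rho z -> 0 < r -> 0 < W z r.
  by move=> Xz r0; rewrite WE; apply: folded_mass_gt0 => //; rewrite divr_gt0.
have W_double z r : X0 rho z -> 0 < r -> W z (2 * r) <= 2 ^+ s * W z r.
  by move=> Xz r0; rewrite !WE -mulrA; apply: Hs => //; rewrite divr_gt0.
have W_mono z y r r' : X0 rho z -> X0 rho y -> 0 < r -> D z y + r <= r' -> W z r <= W y r'.
  move=> Xz Xy _ H; rewrite !WE; apply: folded_mass_mono => //.
  by rewrite ler_pdivlMr// mulrDl divfK ?gt_eqF// mulrC.
have m_ge0 v : v \in S -> 0 <= m v by move=> _; exact: cell_mass_ge0.
have m_upper z r : X0 rho z -> 0 <= r ->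
    \sum_(v <- S | D z v <= r) m v <= W z (r + delta).
  by move=> Xz _; exact: (sum_cell_mass_le mX w0 wi D_tri mB SX cover).
have m_lower z r : X0 rho z -> 0 < r ->
    W z r <= \sum_(v <- S | D z v <= r + delta) m v.
  by move=> Xz _; exact: (sum_cell_mass_ge mX w0 wi D_sym D_tri mB SX cover).
have bm f : PiE rho n f -> bounded_measurable (X0 rho) f.
  by move=> Pf; split; [exact: measurable_PiE Pf|exact: PiE_bounded Pf].
have I_lin a f g : PiE rho n f -> PiE rho n g ->
    wint (sigma rho) (X0 rho) w (fun x => a * f x + g x) =
    a * wint (sigma rho) (X0 rho) w f + wint (sigma rho) (X0 rho) w g.
  by move=> Pf Pg; apply: wint_lin => //; exact: bm.
have I_osc f h : PiE rho n f ->
    (forall z y, z \in S -> X0 rho y -> D z y <= delta -> `|f y - f z| <= h z) ->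
    `|wint (sigma rho) (X0 rho) w f - \sum_(z <- S) m z * f z| <= \sum_(z <- S) m z * h z.
  by move=> Pf; apply: (wint_oscillation mX w0 wi mB SX cover); exact: bm.
have small : C0 * delta * A <= 2^-1.
  move: delta_A; rewrite -div1r ltr_pdivlMr; last by rewrite mulr_gt0// mulr_gt0.
  by move: (A) => B; lra.
have [a [aE abnd]] := positive_quadrature D_ge0 D_xx D_sym D_tri DK W_gt0 W_double
  W_mono SX m_ge0 delta0 m_upper m_lower erefl C00 eps0 eps1 C0eps (ltW delta_eps)
  (finmap.fset_uniq _) (PiE_cst rho n 1) (@PiE_lin _ _ rho n) I_lin
  (@PiE_bounded _ _ rho n) (fun f Pf => lip n f n1 Pf) I_osc (ker n) small.
have mass z : Xi z -> (4 * cd)^-1 * cball_mass rho w z (delta / n%:R) <= a z <=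
    4 * CK * 2 ^+ (s.*2 + 2) * (2 / delta) ^+ s * cball_mass rho w z (delta / n%:R).
  move=> Xiz; have zS : z \in S by rewrite SE inE.
  have Xz := SX _ zS; have /andP[a1 a2] := abnd _ zS.
  have /andP[m1 _] := cell_mass_bounds mX w0 wi mB SX cover Xz.
  have h1 := cball_mass_le_folded hw (delta / n%:R) Xz.
  have h2 := folded_mass_le hw w_even (delta / n%:R) Xz.
  rewrite -/(W z delta) WE in m1; rewrite WE in a2.
  apply/andP; split.
    apply: le_trans a1; rewrite ler_pdivlMr//; apply: le_trans m1.
    rewrite (_ : _ * 2 = cball_mass rho w z (delta / n%:R) / (2 * cd)).
      by rewrite ler_wpM2r// invr_ge0; lra.
    by field; lra.
  apply: le_trans a2 _.
  rewrite (_ : 4 * CK * 2 ^+ (s.*2 + 2) * (2 / delta) ^+ s * cball_mass rho w z (delta / n%:R)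
    = 2 * CK * 2 ^+ (s.*2 + 2) * (2 / delta) ^+ s * (2 * cball_mass rho w z (delta / n%:R))); last by ring.
  rewrite ler_wpM2l// ltW//; apply: mulr_gt0; last by rewrite pow_gt0 ?divr_gt0.
  by rewrite mulr_gt0 ?mulr_gt0 ?pow_gt0.
exists a; split.
- move=> z Xiz; have zS : z \in S by rewrite SE inE.
  have Xz := SX _ zS; have /andP[a1 _] := abnd _ zS.
  apply: lt_le_trans a1; rewrite divr_gt0//.
  have /andP[m1 _] := cell_mass_bounds mX w0 wi mB SX cover Xz.
  by apply: lt_le_trans m1; rewrite divr_gt0 ?W_gt0//; lra.
- move=> f Pf; rewrite fsbig_finite//= -[in RHS](aE _ Pf) /wint /Rintegral fineK//.
  by apply: integrable_fin_num => //; apply: wint_integrable => //; exact: bm Pf.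
- move=> z Xiz; have Xz := XiX _ Xiz.
  by rewrite weight_measure_cball// -!EFinM !lee_fin; exact: mass.
Qed.
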